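(* Suppose $H\in\mathscr{E}$, $G$ is a t.d.l.c.s.c. group, and $\psi:H\to G$ is a continuous, injective homomorphism. If $\psi(H)$ is normal and dense in $G$, then $G\in\mathscr{E}$.
   Context: A t.d.l.c.s.c. group is a totally disconnected locally compact second countable (Hausdorff) topological group. The class $\mathscr{E}$ of elementary groups is the smallest class of t.d.l.c.s.c. groups such that: (i) $\mathscr{E}$ contains all second countable profinite groups and all countable discrete groups; (ii) if $G$ is a t.d.l.c.s.c. group and $H\trianglelefteq G$ is a closed normal subgroup with $H\in\mathscr{E}$ and $G/H$ either profinite or discrete, then $G\in\mathscr{E}$; (iii) if $G$ is a t.d.l.c.s.c. group and $G=\bigcup_{i\in\mathbb{N}}O_i$ where $(O_i)_{i\in\mathbb{N}}$ is an $\subseteq$-increasing sequence of open subgroups of $G$ with $O_i\in\mathscr{E}$ for each $i$, then $G\in\mathscr{E}$. *)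

(* Defs.v *)
From HB Require Import structures.
From mathcomp Require Import all_boot.
From mathcomp Require Import all_classical.
From mathcomp Require Import topology.

Set Implicit Arguments.
Unset Strict Implicit.
Unset Printing Implicit Defensive.

Local Open Scope classical_set_scope.
Local Open Scope quotient_scope.
Local Open Scope group_scope.

HB.mixin Record isTopologicalGroup G of Topological G & Group G := {
  mulg_continuous : continuous (fun x : G * G => x.1 * x.2);
  invg_continuous : continuous (fun x : G => x^-1)
}.

#[short(type="topologicalGroupType")]
HB.structure Definition TopologicalGroup :=
  {G of Topological G & Group G & isTopologicalGroup G}.

Definition is_subgroup (G : groupType) (A : set G) : Prop :=
  [/\ A 1, forall x y, A x -> A y -> A (x * y) & forall x, A x -> A x^-1].

Definition is_normal_subgroup (G : groupType) (A : set G) : Prop :=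
  is_subgroup A /\ forall x g, A x -> A (x ^ g).

Record subgroup (G : groupType) := Subgroup {
  subgroup_set :> set G;
  subgroupP : is_subgroup subgroup_set
}.

Record normal_subgroup (G : groupType) := NormalSubgroup {
  normal_sg :> subgroup G;
  normal_subgroupP : is_normal_subgroup normal_sg
}.

(* The topology on [set_type H] is the one induced from the ambient group. *)
Section SubgroupType.
Variables (G : topologicalGroupType) (H : subgroup G).

Definition subgroup_type : Type := set_type H.

HB.instance Definition _ := SubType.on subgroup_type.
HB.instance Definition _ := Topological.copy subgroup_type (set_type H).

Lemma subgroup_group_closed : group_closed [pred x : G | x \in (H : set G)].
Proof.
have [H1 HM HV] := subgroupP H.
split=> [|x y]; rewrite !inE => //.
by move=> Hx Hy; apply: HM => //; apply: HV.
Qed.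

HB.instance Definition _ :=
  SubChoice_isSubGroup.Build G _ subgroup_type subgroup_group_closed.

Lemma subgroup_val_continuous : continuous (val : subgroup_type -> G).
Proof. exact: initial_continuous. Qed.

Lemma subgroup_mul_continuous :
  continuous (fun x : subgroup_type * subgroup_type => x.1 * x.2).
Proof.
apply: (@continuous_comp_initial _ _ _ (set_val : set_type H -> G)) => x.
apply: (@continuous_comp _ _ _ (fun x : subgroup_type * subgroup_type =>
  (val x.1, val x.2)) (fun y : G * G => y.1 * y.2)); last first.
  exact: mulg_continuous.
apply: cvg_pair => /=.
  by apply: continuous_comp; [exact: cvg_fst | exact: subgroup_val_continuous].
by apply: continuous_comp; [exact: cvg_snd | exact: subgroup_val_continuous].
Qed.

Lemma subgroup_inv_continuous : continuous (fun x : subgroup_type => x^-1).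
Proof.
apply: (@continuous_comp_initial _ _ _ (set_val : set_type H -> G)) => x.
rewrite (_ : _ \o _ = (fun y : G => y^-1) \o (val : subgroup_type -> G)).
  2: by apply/funext => y; exact: (gmulfV (val : subgroup_type -> G) y).
apply: continuous_comp.
  exact: subgroup_val_continuous.
exact: invg_continuous.
Qed.

HB.instance Definition _ := isTopologicalGroup.Build subgroup_type
  subgroup_mul_continuous subgroup_inv_continuous.

End SubgroupType.

Section QuotientGroup.
Variables (G : topologicalGroupType) (N : normal_subgroup G).

Local Notation P := (N : set G).

Definition coset_rel : rel G := fun x y => (x^-1 * y) \in P.

Lemma normal1 : P 1.
Proof. by have [] := subgroupP N. Qed.
Lemma normalM x y : P x -> P y -> P (x * y).
Proof. by have [_ + _] := subgroupP N; apply. Qed.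
Lemma normalV x : P x -> P x^-1.
Proof. by have [_ _] := subgroupP N; apply. Qed.
Lemma normalJ x g : P x -> P (x ^ g).
Proof. by have [_] := normal_subgroupP N; apply. Qed.

Lemma coset_refl : reflexive coset_rel.
Proof. by move=> x; apply/mem_set; rewrite mulVg; exact: normal1. Qed.

Lemma coset_sym : symmetric coset_rel.
Proof.
by move=> x y; apply/idP/idP; rewrite !inE => /normalV; rewrite invgM invgK.
Qed.

Lemma coset_trans : transitive coset_rel.
Proof.
move=> y x z /set_mem xy /set_mem yz; apply/mem_set.
by have := normalM xy yz; rewrite mulgA mulgK.
Qed.

Canonical coset_equiv := EquivRel coset_rel coset_refl coset_sym coset_trans.

(* The set of left cosets with the quotient topology. *)
Definition quotient_group : Type := quotient_topology {eq_quot coset_rel}.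

HB.instance Definition _ := Quotient.on quotient_group.
HB.instance Definition _ :=
  Topological.copy quotient_group (quotient_topology {eq_quot coset_rel}).

Definition coset : G -> quotient_group := \pi_quotient_group.

Lemma coset_eqP x y : coset x = coset y <-> P (x^-1 * y).
Proof.
split=> [/eqmodP/set_mem //|Nxy]; apply/eqmodP; exact/mem_set.
Qed.

Lemma coset_reprK (u : quotient_group) : coset (repr u) = u.
Proof. exact: reprK. Qed.

Lemma repr_cosetP x : P ((repr (coset x))^-1 * x).
Proof. by apply/coset_eqP; rewrite coset_reprK. Qed.

Definition quotient_one : quotient_group := coset 1.
Definition quotient_mul (u v : quotient_group) : quotient_group :=
  coset (repr u * repr v).
Definition quotient_inv (u : quotient_group) : quotient_group :=
  coset (repr u)^-1.

Lemma quotient_mulE x y : quotient_mul (coset x) (coset y) = coset (x * y).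
Proof.
apply/coset_eqP; rewrite invgM.
have := normalM (repr_cosetP y) (normalJ y (repr_cosetP x)).
by rewrite /conjg !mulgA mulgK.
Qed.

Lemma quotient_invE x : quotient_inv (coset x) = coset x^-1.
Proof.
apply/coset_eqP; rewrite invgK.
have := normalJ x^-1 (normalV (repr_cosetP x)).
by rewrite /conjg invgM !invgK !mulgA mulgV mul1g.
Qed.

Lemma quotient_mulA : associative quotient_mul.
Proof.
move=> u v w; rewrite -(coset_reprK u) -(coset_reprK v) -(coset_reprK w).
by rewrite !quotient_mulE mulgA.
Qed.

Lemma quotient_mul1 : left_id quotient_one quotient_mul.
Proof. by move=> u; rewrite -(coset_reprK u) quotient_mulE mul1g. Qed.

Lemma quotient_mulr1 : right_id quotient_one quotient_mul.
Proof. by move=> u; rewrite -(coset_reprK u) quotient_mulE mulg1. Qed.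

Lemma quotient_mulV : left_inverse quotient_one quotient_inv quotient_mul.
Proof. by move=> u; rewrite -(coset_reprK u) quotient_invE quotient_mulE mulVg. Qed.

Lemma quotient_mulrV : right_inverse quotient_one quotient_inv quotient_mul.
Proof. by move=> u; rewrite -(coset_reprK u) quotient_invE quotient_mulE mulgV. Qed.

HB.instance Definition _ := isGroup.Build quotient_group
  quotient_mulA quotient_mul1 quotient_mulr1 quotient_mulV quotient_mulrV.

Lemma coset_continuous : continuous coset.
Proof. exact: pi_continuous. Qed.

Lemma mulgr_continuous (y : G) : continuous (fun x : G => x * y).
Proof.
move=> x; apply: (@continuous_comp _ _ _ (fun x : G => (x, y))
  (fun z : G * G => z.1 * z.2)); last exact: mulg_continuous.
by apply: cvg_pair; [exact: cvg_id | exact: cvg_cst].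
Qed.

Lemma coset_open (U : set G) : open U -> open (coset @` U).
Proof.
move=> oU; rewrite /open /= /quotient_open.
rewrite (_ : _ @^-1` _ = \bigcup_(n in P) (fun x => x * n) @^-1` U).
  by apply: bigcup_open => n _; move/continuousP: (@mulgr_continuous n); apply.
apply/seteqP; split=> [x [y Uy /esym/coset_eqP Nxy]|x [n Nn Uxn]].
  by exists (x^-1 * y) => //=; rewrite mulgA mulgV mul1g.
by exists (x * n) => //; apply/esym/coset_eqP; rewrite mulgA mulVg mul1g.
Qed.

Lemma quotient_mul_continuous :
  continuous (fun u : quotient_group * quotient_group => u.1 * u.2).
Proof.
move=> [u v] W; rewrite -(coset_reprK u) -(coset_reprK v) => /= nW.
have : nbhs (repr u, repr v) [set z : G * G | W (coset (z.1 * z.2))].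
  apply: (@continuous_comp _ _ _ (fun z : G * G => z.1 * z.2) coset).
  - exact: mulg_continuous.
  - exact: coset_continuous.
  - by rewrite /= -quotient_mulE.
case=> [[A B]] /= [].
rewrite nbhsE => -[A' [oA' A'u] A'A]; rewrite nbhsE => -[B' [oB' B'v] B'B] AB.
exists (coset @` A', coset @` B') => /=.
  split; apply: open_nbhs_nbhs; split.
  - exact: coset_open.
  - by exists (repr u).
  - exact: coset_open.
  - by exists (repr v).
move=> [_ _] /= [[x A'x <-] [y B'y <-]].
rewrite -[_ * _]/(quotient_mul _ _) quotient_mulE.
by apply: (AB (x, y)); split; [exact: A'A | exact: B'B].
Qed.

Lemma quotient_inv_continuous : continuous (fun u : quotient_group => u^-1).
Proof.
apply/quotient_continuous => x.
rewrite (_ : _ \o _ = coset \o (fun y : G => y^-1)); last first.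
  by apply/funext => y; exact: quotient_invE.
by apply: continuous_comp; [exact: invg_continuous | exact: coset_continuous].
Qed.

HB.instance Definition _ := isTopologicalGroup.Build quotient_group
  quotient_mul_continuous quotient_inv_continuous.

End QuotientGroup.

Definition discrete_space (T : topologicalType) : Prop :=
  forall A : set T, open A.

Definition tdlcsc (G : topologicalGroupType) : Prop :=
  [/\ hausdorff_space G, totally_disconnected [set: G],
      locally_compact [set: G] & @second_countable G].

Definition profinite (G : topologicalGroupType) : Prop :=
  [/\ hausdorff_space G, totally_disconnected [set: G] & compact [set: G]].

(* The groups of the first two constructors are automatically [tdlcsc]. *)
Inductive elementary : topologicalGroupType -> Prop :=
| elementary_profinite (G : topologicalGroupType) :
    profinite G -> @second_countable G -> elementary G
| elementary_discrete (G : topologicalGroupType) :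
    discrete_space G -> countable [set: G] -> elementary G
| elementary_extension (G : topologicalGroupType) (N : normal_subgroup G) :
    tdlcsc G -> closed (N : set G) -> elementary (subgroup_type N) ->
    profinite (quotient_group N) \/ discrete_space (quotient_group N) ->
    elementary G
| elementary_union (G : topologicalGroupType) (O : nat -> subgroup G) :
    tdlcsc G -> (forall i, open (O i : set G)) ->
    (forall i, O i `<=` O i.+1) -> \bigcup_i (O i : set G) = setT ->
    (forall i, elementary (subgroup_type (O i))) ->
    elementary G.

(* Main.v *)
(* The induction on [H] is carried out for the more general data
   [i : L -> H], [psi : L -> G], with [i] and [psi] continuous injective
   homomorphisms and [psi] of dense normal image. The group [G] acts on [L] by
   conjugation through [psi]; by Baire category each element acts continuously
   and compact sets of [G] move compact sets of [L] inside compact sets.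
   If [U] is a compact open subgroup of [G], then [L] is an increasing union of
   [U]-invariant open compactly generated subgroups [O], and [G] that of the
   open subgroups [psi(O) U], in which the closure of [psi(O)] is cocompact; so
   [L] may be assumed compactly generated. Let then [R] be the intersection of
   the open normal subgroups of [L] and [M] the closure of [psi(R)]. It suffices
   that [M] is elementary. Indeed, for [V] compact open in [L], some open normal
   [W] of [L] lies in [R V] (compact generation), so the closure [D] of [psi(W)]
   is compact modulo [M]; the centraliser of [psi(L)] modulo [D] is open, since
   [psi(L) D / D] is countable and generated modulo [D] by a compact set, and it
   contains an open normal subgroup of [G] that is compact modulo [M].
   Finally [R] is trivial when [H] is profinite or discrete, [i(R)] lies in [N]
   when [H] is an extension by [N], and [i(L)] lies in some [O_n] when [H] is a
   union of the [O_n]. *)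

Require Import Defs.
From mathcomp Require Import all_boot.
From mathcomp Require Import all_classical.
From mathcomp Require Import topology.

Set Implicit Arguments.
Unset Strict Implicit.
Unset Printing Implicit Defensive.

Local Open Scope classical_set_scope.
Local Open Scope group_scope.

(** * Compactness arguments and zero-dimensionality *)

Section Topology.
Implicit Types T : topologicalType.

(** A substitute for extracting finite subcovers: if [P K] failed, the sets [A] with [P (K \ A)]
    would form a proper filter containing [K], and [P] could not hold on any neighbourhood of a
    cluster point. *)
Lemma compact_ind T (K : set T) (P : set T -> Prop) :
  compact K -> P set0 -> (forall A B, P A -> P B -> P (A `|` B)) ->
  (forall A B, A `<=` B -> P B -> P A) ->
  (forall x, K x -> exists2 N, nbhs x N & P N) -> P K.
Proof.
move=> cK P0 PU PS PN; apply: contrapT => nPK.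
pose F := [set A | P (K `\` A)].
have FF : ProperFilter F.
  split; first by rewrite /F /= setD0.
  split; first by rewrite /F /= setDT.
    by move=> A B FA FB; rewrite /F /= setDIr; exact: PU.
  by move=> A B AB; apply: PS; exact: setDS.
have [|x [Kx clx]] := cK F FF; first by rewrite /F /= setDv.
have [N xN PNN] := PN x Kx.
have FN : F (~` N) by apply: PS PNN => y [_ /contrapT].
by have [y []] := clx _ _ FN xN.
Qed.

Lemma compact_increasing_cover T (K : set T) (O : nat -> set T) :
  compact K -> (forall n, open (O n)) -> (forall n, O n `<=` O n.+1) ->
  K `<=` \bigcup_n O n -> exists n, K `<=` O n.
Proof.
move=> cK oO O_incr KO.
have O_le m n : (m <= n)%N -> O m `<=` O n.
  move=> /subnKC <-; elim: (n - m)%N => [|k IHk]; first by rewrite addn0.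
  by rewrite addnS; apply: subset_trans IHk _.
apply: (compact_ind (P := fun K => exists n, K `<=` O n) cK)
  => [|A B [m Am] [n Bn]|A B AB [n Bn]|x /KO [n _ On]].
- by exists 0%N.
- exists (maxn m n) => x [/Am|/Bn]; apply: O_le; [exact: leq_maxl|exact: leq_maxr].
- by exists n; apply: subset_trans Bn.
- by exists (O n); [exact: open_nbhs_nbhs|exists n].
Qed.

Lemma hausdorff_nbhs T (x y : T) : hausdorff_space T -> x <> y ->
  exists A B, [/\ open A, open B, A x, B y & A `&` B = set0].
Proof.
rewrite open_hausdorff => hT /eqP /hT [[A B]] /=; rewrite !inE.
by move=> [Ax By] [oA oB AB0]; exists A, B; split=> //; exact/eqP.
Qed.

Lemma compact_separation T (K L : set T) : hausdorff_space T ->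
  compact K -> compact L -> K `&` L = set0 ->
  exists A B, [/\ open A, open B, K `<=` A, L `<=` B & A `&` B = set0].
Proof.
move=> hT cK cL KL0.
have point x : K x -> exists A B, [/\ open A, open B, A x, L `<=` B & A `&` B = set0].
  move=> Kx; apply: (compact_ind (P := fun L => exists A B,
    [/\ open A, open B, A x, L `<=` B & A `&` B = set0]) cL).
  - by exists setT, set0; split => //; [exact: openT|exact: open0|rewrite setI0].
  - move=> L1 L2 [A1 [B1 [oA1 oB1 A1x L1B AB1]]] [A2 [B2 [oA2 oB2 A2x L2B AB2]]].
    exists (A1 `&` A2), (B1 `|` B2); split=> //; [exact: openI|exact: openU| |].
      by move=> z [/L1B|/L2B]; [left|right].
    apply/seteqP; split=> // z [[A1z A2z] [B1z|B2z]].
      by rewrite -[set0]AB1.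
    by rewrite -[set0]AB2.
  - by move=> L1 L2 L12 [A [B [? ? ? L2B ?]]]; exists A, B; split=> // z /L12 /L2B.
  - move=> y Ly; have /(hausdorff_nbhs hT) [A [B [oA oB Ax By AB]]] : x <> y.
      by move=> xy; rewrite -[False]/(set0 x) -KL0; split=> //; rewrite xy.
    by exists B; [exact: open_nbhs_nbhs|exists A, B; split=> //].
apply: (compact_ind (P := fun K => exists A B,
    [/\ open A, open B, K `<=` A, L `<=` B & A `&` B = set0]) cK).
- by exists set0, setT; split => //; [exact: open0|exact: openT|rewrite set0I].
- move=> K1 K2 [A1 [B1 [oA1 oB1 K1A L1B AB1]]] [A2 [B2 [oA2 oB2 K2A L2B AB2]]].
  exists (A1 `|` A2), (B1 `&` B2); split=> //; [exact: openU|exact: openI| | |].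
  + by move=> z [/K1A|/K2A]; [left|right].
  + by move=> z Lz; split; [exact: L1B|exact: L2B].
  + apply/seteqP; split=> // z [[A1z|A2z] [B1z B2z]].
      by rewrite -[set0]AB1.
    by rewrite -[set0]AB2.
- by move=> K1 K2 K12 [A [B [? ? K2A ? ?]]]; exists A, B; split=> // z /K12 /K2A.
- move=> x /point [A [B [oA oB Ax LB AB]]].
  by exists A; [exact: open_nbhs_nbhs|exists A, B; split].
Qed.

(* In a compact set [K] the component of [x] is the intersection [Q] of the
   relatively clopen subsets of [K] containing [x]. *)
Lemma compact_open_base T (x : T) (N : set T) :
  hausdorff_space T -> totally_disconnected [set: T] ->
  locally_compact [set: T] -> nbhs x N ->
  exists A, [/\ open A, compact A, A x & A `<=` N].
Proof.
move=> hT tdT lcT xN.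
have [K xK [cK clK]] : exists2 K, nbhs x K & compact K /\ closed K.
  have [K xK cK] := lcT x I; exists K => //.
  by move: xK; rewrite /within /= => /filterS; apply => y; apply.
have Kx := nbhs_singleton xK.
pose rc (A : set T) := [/\ A `<=` K, closed A, closed (K `\` A) & A x].
have rcI A B : rc A -> rc B -> rc (A `&` B).
  move=> [AK cA cKA Ax] [BK cB cKB Bx]; split=> //.
  - by move=> z [/AK].
  - exact: closedI.
  - by rewrite setDIr; exact: closedU.
have rcK : rc K by split=> //; rewrite setDv; exact: closed0.
pose Q := [set y | forall A, rc A -> A y].
have QK : Q `<=` K by move=> y /(_ K rcK).
have Qx : Q x by move=> A [].
have clQ : closed Q.
  rewrite (_ : Q = \bigcap_(A in rc) A); last by [].
  by apply: closed_bigI => A [].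
(* Each point of [L] is missed by some member of [rc], and [rc] is stable under finite
   intersections, so by compactness a single member misses [L]. *)
have shrink L : compact L -> L `<=` K -> L `&` Q = set0 ->
    exists2 A, rc A & A `&` L = set0.
  move=> cL LK LQ0; apply: (compact_ind (P := fun L =>
    exists2 A, rc A & A `&` L = set0) cL).
  - by exists K => //; rewrite setI0.
  - move=> L1 L2 [A1 rA1 A10] [A2 rA2 A20]; exists (A1 `&` A2); first exact: rcI.
    apply/seteqP; split=> // z [[A1z A2z] [L1z|L2z]].
      by rewrite -[set0]A10.
    by rewrite -[set0]A20.
  - move=> L1 L2 L12 [A rA A0]; exists A => //.
    by apply/seteqP; split=> // z [Az /L12 L2z]; rewrite -[set0]A0.
  - move=> y Ly; have : ~ Q y by move=> Qy; rewrite -[False]/(set0 y) -LQ0.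
    move=> /existsNP [A /not_implyP [rA nAy]]; exists (~` A).
      by apply: open_nbhs_nbhs; split=> //; apply: closed_openC; case: rA.
    by exists A => //; rewrite setICr.
(* Disjoint open sets [O1] and [O2] separate [B] from the rest of [Q]. Some [A] in [rc] lies in
   their union; then [A \ O2] is again in [rc], hence contains [Q], which forces [Q \ B] to be
   empty. *)
have Qpart B : B `<=` Q -> closed B -> closed (Q `\` B) -> B x -> Q `\` B = set0.
  move=> BQ clB clQB Bx.
  have cB : compact B by apply: (subclosed_compact clB cK) => z /BQ /QK.
  have cC : compact (Q `\` B) by apply: (subclosed_compact clQB cK) => z [/QK].
  have [|O1 [O2 [oO1 oO2 BO1 CO2 O12]]] := compact_separation hT cB cC.
    by apply/seteqP; split=> // z [Bz []].
  have [] := shrink (K `\` (O1 `|` O2)).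
  - by apply: compact_closedI => //; apply: open_closedC; exact: openU.
  - by move=> z [].
  - apply/seteqP; split=> // z [[_ nO] Qz]; apply: nO.
    by have [Bz|nBz] := pselect (B z); [left; exact: BO1|right; apply: CO2].
  move=> A [AK clA clKA Ax] A0.
  have AO z : A z -> O1 z \/ O2 z.
    move=> Az; apply: contrapT => nO; rewrite -[False]/(set0 z) -A0; split=> //.
    by split; [exact: AK|].
  have rA1 : rc (A `\` O2).
    split.
    - by move=> z [/AK].
    - by apply: closedI => //; exact: open_closedC.
    - rewrite (_ : _ `\` _ = (K `\` A) `|` (A `\` O1)).
        by apply: closedU => //; apply: closedI => //; exact: open_closedC.
      apply/seteqP; split=> z.
        move=> [Kz nAz]; have [Az|] := pselect (A z); last by left.
        right; split=> // O1z; apply: nAz; split=> // O2z.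
        by rewrite -[False]/(set0 z) -O12.
      move=> [[Kz nAz]|[Az nO1]]; first by split=> // -[].
      by split; [exact: AK|move=> [_ nO2]; have [] := AO z Az].
    - split=> // O2x; rewrite -[False]/(set0 x) -O12; split=> //; exact: BO1.
  apply/seteqP; split=> // z [Qz nBz]; have [_] := Qz _ rA1; apply; exact: CO2.
have cQ : connected Q.
  move=> B [y By] [O oO BO] [F clF BF].
  have BQ : B `<=` Q by rewrite BO => z [].
  have clB : closed B by rewrite BF; exact: closedI.
  have clQB : closed (Q `\` B).
    rewrite BO setDIr setDv set0U; apply: closedI => //; exact: open_closedC.
  have [Bx|nBx] := pselect (B x).
    apply/seteqP; split=> // z Qz; apply: contrapT => nBz.
    by rewrite -[False]/(set0 z) -(Qpart B).
  have QBB : Q `\` (Q `\` B) = B.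
    apply/seteqP; split=> z; first by move=> [Qz nQB]; apply: contrapT => nBz; exact: nQB.
    by move=> Bz; split; [exact: BQ|move=> []].
  have : B y by [].
  by rewrite -QBB Qpart // ?QBB // => z [].
have Q1 : Q = [set x].
  apply/seteqP; split=> [y Qy|_ -> //].
  have <- : connected_component setT x = [set x] by exact: tdT.
  exact: (connected_component_max Qx).
(* Keeping [A] inside the interior of [K] makes it open in the whole space and not only relatively
   to [K]. *)
have [] := shrink (K `\` (N° `&` K°)).
- apply: compact_closedI => //; apply: open_closedC.
  by apply: openI; exact: open_interior.
- by move=> z [].
- by rewrite Q1; apply/seteqP; split=> // z [[_ nz] zx]; apply: nz; rewrite zx; split.
move=> A [AK clA clKA Ax] A0.
have AN : A `<=` N° `&` K°.
  move=> z Az; apply: contrapT => nz; rewrite -[False]/(set0 z) -A0.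
  by split=> //; split=> //; exact: AK.
exists A; split=> //.
- rewrite (_ : A = K° `&` ~` (K `\` A)).
    by apply: openI; [exact: open_interior|exact: closed_openC].
  apply/seteqP; split=> z; first by move=> Az; split; [case: (AN z Az)|move=> []].
  by move=> [/interior_subset Kz nz]; apply: contrapT => nAz; apply: nz.
- exact: subclosed_compact clA cK AK.
- by move=> z /AN [/interior_subset].
Qed.

Lemma continuous_closure_homo T1 T2 (f : T1 -> T2) (A : set T1) (B : set T2) :
  continuous f -> (forall x, A x -> closure B (f x)) ->
  forall x, closure A x -> closure B (f x).
Proof.
move=> cf AB x Ax.
have cl : closed (f @^-1` closure B) by apply: preimage_closed => //; exact: closed_closure.
by move/(_ x (closureS AB Ax)): cl.
Qed.

End Topology.

(** * Homomorphisms and subgroups of abstract groups *)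

Section Morphisms.
Variables (G H : groupType) (f : G -> H).
Hypothesis fM : {morph f : x y / x * y}.

Lemma morph_mulg1 : f 1 = 1.
Proof. by apply: (mulgI (f 1)); rewrite -fM !mulg1. Qed.

Lemma morph_mulgV : {morph f : x / x^-1}.
Proof. by move=> x; apply: (mulgI (f x)); rewrite -fM !mulgV morph_mulg1. Qed.

Lemma morph_mulgJ : {morph f : x y / x ^ y}.
Proof. by move=> x y; rewrite !conjgE !fM morph_mulgV. Qed.

Lemma preimage_subgroup (A : set H) : is_subgroup A -> is_subgroup (f @^-1` A).
Proof.
move=> [A1 AM AV]; split=> [|x y Ax Ay|x Ax] /=.
- by rewrite morph_mulg1.
- by rewrite fM; exact: AM.
- by rewrite morph_mulgV; exact: AV.
Qed.

Lemma image_subgroup (A : set G) : is_subgroup A -> is_subgroup (f @` A).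
Proof.
move=> [A1 AM AV]; split=> [|_ _ [x Ax <-] [y Ay <-]|_ [x Ax <-]].
- by exists 1 => //; rewrite morph_mulg1.
- by exists (x * y); [exact: AM|rewrite fM].
- by exists x^-1; [exact: AV|rewrite morph_mulgV].
Qed.

End Morphisms.

Section Subgroups.
Variable G : groupType.
Implicit Types A B : set G.

Lemma subgroup_conj A x g : is_subgroup A -> A x -> A g -> A (x ^ g).
Proof. by move=> [A1 AM AV] Ax Ag; apply: (AM); [exact: AV|exact: AM]. Qed.

Lemma subgroupI A B : is_subgroup A -> is_subgroup B -> is_subgroup (A `&` B).
Proof.
move=> [A1 AM AV] [B1 BM BV]; split=> // [x y [Ax Bx] [Ay By]|x [Ax Bx]].
  by split; [exact: AM|exact: BM].
by split; [exact: AV|exact: BV].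
Qed.

Lemma subgroup_bigcap I (D : set I) (F : I -> set G) :
  (forall i, D i -> is_subgroup (F i)) -> is_subgroup (\bigcap_(i in D) F i).
Proof.
move=> DF; split=> [i /DF []//|x y Fx Fy i Di|x Fx i Di].
  by have [_ FM _] := DF i Di; apply: FM; [exact: Fx|exact: Fy].
by have [_ _ FV] := DF i Di; apply: FV; exact: Fx.
Qed.

Definition generated A := smallest (@is_subgroup G) A.

Lemma generated_subgroup A : is_subgroup (generated A).
Proof. by apply: subgroup_bigcap => B []. Qed.

Lemma subgroup_mul A B : is_subgroup A -> is_subgroup B ->
  (forall x g, A x -> B g -> A (x ^ g)) ->
  is_subgroup [set x * y | x in A & y in B].
Proof.
move=> [A1 AM AV] [B1 BM BV] AB.
split=> [|_ _ [x Ax [y By <-]] [z Az [t Bt <-]]|_ [x Ax [y By <-]]].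
- by exists 1 => //; exists 1 => //; rewrite mulg1.
- exists (x * z ^ y^-1); first by apply: (AM) => //; apply: (AB) => //; exact: BV.
  by exists (y * t); [exact: BM|rewrite conjgE invgK !mulgA mulgVK].
- exists (x^-1 ^ y); first by apply: (AB) => //; exact: AV.
  by exists y^-1; [exact: BV|rewrite conjgE invgM !mulgA mulgK].
Qed.

End Subgroups.

(** * Topological groups and compact open subgroups *)

Section ContinuousOperations.
Variables (T : topologicalType) (G : topologicalGroupType).

Lemma continuous_mulg (f g : T -> G) :
  continuous f -> continuous g -> continuous (fun x => f x * g x).
Proof.
move=> cf cg x; apply: (@continuous_comp _ _ _ (fun x => (f x, g x))
  (fun z : G * G => z.1 * z.2)); last exact: mulg_continuous.
by apply: cvg_pair; [exact: cf|exact: cg].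
Qed.

Lemma continuous_invg (f : T -> G) :
  continuous f -> continuous (fun x => (f x)^-1).
Proof.
by move=> cf x; apply: (@continuous_comp _ _ _ f (fun z : G => z^-1));
  [exact: cf|exact: invg_continuous].
Qed.

Lemma continuous_conjg (f g : T -> G) :
  continuous f -> continuous g -> continuous (fun x => f x ^ g x).
Proof.
move=> cf cg; rewrite /conjg; apply: continuous_mulg.
  exact: continuous_invg.
exact: continuous_mulg.
Qed.

End ContinuousOperations.

Section TopologicalGroups.
Variable G : topologicalGroupType.
Implicit Types A B : set G.

Let cst_cont (T : topologicalType) (x : G) : continuous (fun _ : T => x).
Proof. by move=> y; exact: cvg_cst. Qed.

Let id_cont : continuous (fun x : G => x).
Proof. by move=> y; exact: cvg_id. Qed.

Let fst_cont (T : topologicalType) : continuous (fun x : G * T => x.1).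
Proof. by move=> y; exact: cvg_fst. Qed.

Let snd_cont (T : topologicalType) : continuous (fun x : T * G => x.2).
Proof. by move=> y; exact: cvg_snd. Qed.

Lemma mulgl_continuous (x : G) : continuous (fun y : G => x * y).
Proof. by apply: continuous_mulg; [exact: cst_cont|exact: id_cont]. Qed.

Lemma conjgl_continuous (g : G) : continuous (fun x : G => x ^ g).
Proof. by apply: continuous_conjg; [exact: id_cont|exact: cst_cont]. Qed.

Lemma conjgr_continuous (x : G) : continuous (fun g : G => x ^ g).
Proof. by apply: continuous_conjg; [exact: cst_cont|exact: id_cont]. Qed.

Lemma conjg_continuous : continuous (fun p : G * G => p.1 ^ p.2).
Proof. by apply: continuous_conjg; [exact: fst_cont|exact: snd_cont]. Qed.

Lemma subgroup_open A (x : G) : is_subgroup A -> nbhs x A -> open A.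
Proof.
move=> [A1 AM AV] xA; have Ax := nbhs_singleton xA.
rewrite openE => y Ay; rewrite /interior.
have : nbhs y [set z | A (x * y^-1 * z)].
  by apply: (mulgl_continuous (x := x * y^-1)); rewrite mulgVK.
apply: filterS => z /= Axyz.
have -> : z = y * x^-1 * (x * y^-1 * z) by rewrite -!mulgA mulKg mulVKg.
by apply: (AM) => //; apply: (AM) => //; exact: AV.
Qed.

Lemma open_nbhs1 A : is_subgroup A -> open A -> nbhs (1 : G) A.
Proof. by move=> [A1 _ _] oA; apply: open_nbhs_nbhs. Qed.

Lemma open_subgroup_closed A : is_subgroup A -> open A -> closed A.
Proof.
move=> sA oA; have [A1 AM AV] := sA; move=> x clx.
have [y [Ay /= Ayx]] : A `&` [set y | A (y^-1 * x)] !=set0.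
  apply: clx; apply: (@continuous_mulg _ _ (fun y => y^-1) (fun=> x)).
  - exact: invg_continuous.
  - exact: cst_cont.
  - by rewrite mulVg; exact: open_nbhs1.
by rewrite -(mulVKg y x); exact: AM.
Qed.

Lemma closure_subgroup A : is_subgroup A -> is_subgroup (closure A).
Proof.
move=> [A1 AM AV]; split.
- exact: subset_closure.
- move=> x y clx; move: y; apply: (continuous_closure_homo (mulgl_continuous (x := x))) => y Ay.
  move: x clx; apply: (continuous_closure_homo (@mulgr_continuous G y)) => x Ax.
  by apply: subset_closure; exact: AM.
- apply: continuous_closure_homo; first exact: invg_continuous.
  by move=> x Ax; apply: subset_closure; exact: AV.
Qed.

Lemma closure_conj A (g : G) : (forall x, A x -> A (x ^ g)) ->
  forall x, closure A x -> closure A (x ^ g).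
Proof.
move=> Ag; apply: continuous_closure_homo; first exact: conjgl_continuous.
by move=> x Ax; apply: subset_closure; exact: Ag.
Qed.

(** For fixed [x] in [A], the elements [g] with [x ^ g] in [A] form a closed set containing [D]. *)
Lemma dense_normalizer A D : closed A -> dense D ->
  (forall g, D g -> forall x, A x -> A (x ^ g)) ->
  forall g x, A x -> A (x ^ g).
Proof.
move=> clA dD DA g x Ax.
have cl : closed [set g | A (x ^ g)].
  by apply: preimage_closed => // ? _; exact: conjgr_continuous.
apply: contrapT => nA.
have [h [/= nAh Dh]] := dD (~` [set g | A (x ^ g)]) (ex_intro _ g nA) (closed_openC cl).
by apply: nAh; exact: DA.
Qed.

Lemma compact_mul A B : compact A -> compact B -> compact [set x * y | x in A & y in B].
Proof.
move=> cA cB; have -> : [set x * y | x in A & y in B] =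
    (fun z : G * G => z.1 * z.2) @` (A `*` B).
  apply/seteqP; split=> z; first by move=> [x Ax [y By <-]]; exists (x, y).
  by move=> [[x y] [/= Ax By] <-]; exists x => //; exists y.
apply: continuous_compact; last exact: compact_setX.
by apply: continuous_subspaceT; exact: mulg_continuous.
Qed.

Lemma compact_conj A B : compact A -> compact B -> compact [set x ^ y | x in A & y in B].
Proof.
move=> cA cB; have -> : [set x ^ y | x in A & y in B] =
    (fun z : G * G => z.1 ^ z.2) @` (A `*` B).
  apply/seteqP; split=> z; first by move=> [x Ax [y By <-]]; exists (x, y).
  by move=> [[x y] [/= Ax By] <-]; exists x => //; exists y.
apply: continuous_compact; last exact: compact_setX.
by apply: continuous_subspaceT; exact: conjg_continuous.
Qed.

Lemma compact_lcoset A (x : G) : compact A -> compact [set x * y | y in A].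
Proof.
move=> cA; apply: continuous_compact => //.
by apply: continuous_subspaceT; exact: mulgl_continuous.
Qed.

Lemma compact_inv A : compact A -> compact [set x^-1 | x in A].
Proof.
move=> cA; apply: continuous_compact => //.
by apply: continuous_subspaceT; exact: invg_continuous.
Qed.

Lemma lcoset_open A (x : G) : open A -> open [set y | A (x^-1 * y)].
Proof. by move=> oA; have /continuousP := mulgl_continuous (x := x^-1); exact. Qed.

(** The operation is left arbitrary so as to cover both translation and conjugation. *)
Lemma tube_lemma (T : topologicalType) (op : T * G -> G) (K : set T) (U : set G) :
  continuous op -> open U -> compact K -> (forall x, K x -> U (op (x, 1))) ->
  nbhs 1 [set g | forall x, K x -> U (op (x, g))].
Proof.
move=> cop oU cK KU.
apply: (compact_ind (P := fun K => nbhs 1 [set g | forall x, K x -> U (op (x, g))]) cK).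
- by apply: filterS filterT => g _ x.
- move=> A B PA PB; apply: filterS (filterI PA PB) => g [gA gB] x [Ax|Bx].
    exact: gA.
  exact: gB.
- by move=> A B AB; apply: filterS => g gB x /AB; exact: gB.
- move=> x Kx; have : nbhs (x, 1) [set p | U (op p)].
    by apply: cop; apply: open_nbhs_nbhs; split=> //; exact: KU.
  case=> [[N M] /= [xN M1] NM]; exists N => //.
  by apply: filterS M1 => g Mg y Ny; exact: (NM (y, g)).
Qed.

(** Take a compact open [A] with [1] in [A] and [A] inside [N]. Its right stabiliser [S] is a
    submonoid, and a neighbourhood of [1] by the tube lemma; the symmetric part [V] of [S] is an
    open subgroup, contained in [A] because [1] is in [A]. *)
Lemma van_dantzig (N : set G) :
  hausdorff_space G -> totally_disconnected [set: G] ->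
  locally_compact [set: G] -> nbhs 1 N ->
  exists V, [/\ is_subgroup V, open V, compact V & V `<=` N].
Proof.
move=> hG tdG lcG N1.
have [A [oA cA A1 AN]] := compact_open_base hG tdG lcG N1.
pose S := [set g | forall x, A x -> A (x * g)].
pose V := S `&` [set g | S g^-1].
have S1 : nbhs 1 S.
  apply: (tube_lemma (op := fun p : G * G => p.1 * p.2)) => //; first exact: mulg_continuous.
  by move=> x Ax /=; rewrite mulg1.
have SM x y : S x -> S y -> S (x * y) by move=> Sx Sy z /Sx /Sy; rewrite mulgA.
have sV : is_subgroup V.
  split=> [|x y [Sx SxV] [Sy SyV]|x [Sx SxV]].
  - by split; move=> x /=; rewrite ?invg1 mulg1.
  - by split; [exact: SM|rewrite /= invgM; exact: SM].
  - by split=> //=; rewrite invgK.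
have oV : open V.
  apply: (subgroup_open sV (x := 1)); apply: filterI => //.
  by apply: invg_continuous; rewrite invg1.
have VA : V `<=` A by move=> x [/(_ 1 A1)]; rewrite mul1g.
exists V; split=> //; last exact: subset_trans AN.
by apply: subclosed_compact cA VA; exact: open_subgroup_closed.
Qed.

End TopologicalGroups.

(** * Countability and Baire category in t.d.l.c.s.c. groups *)

Lemma second_countable_separable (T : topologicalType) (x0 : T) :
  @second_countable T ->
  exists x : nat -> T, forall U, open U -> U !=set0 -> exists n, U (x n).
Proof.
move=> [B /countable_injP [f fI] [oB Bbase]].
(* The [n]-th point is chosen in the basic set of code [n], with the default [x0] when there is no
   such set or it is empty. *)
exists (fun n => xget x0 [set p | exists2 b, B b & f b = n /\ b p]) => U oU [y Uy].
have [b [Bb b_y] bU] := Bbase y U (open_nbhs_nbhs (conj oU Uy)).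
exists (f b); case: xgetP => [p _ [b' Bb' [fb' b'p]]|/(_ y)]; last first.
  by case; exists b.
by apply: bU; rewrite -(fI _ _ _ _ fb') ?inE.
Qed.

Section Tdlcsc.
Variable G : topologicalGroupType.
Hypothesis tdG : tdlcsc G.
Implicit Types A B : set G.

Lemma tdlcsc_van_dantzig (N : set G) : nbhs (1 : G) N ->
  exists V, [/\ is_subgroup V, open V, compact V & V `<=` N].
Proof. by have [? ? ? _] := tdG; exact: van_dantzig. Qed.

(** Every left coset of [A] is open, so it contains a term of a dense sequence. *)
Lemma countable_cosets A : is_subgroup A -> open A ->
  exists x : nat -> G, forall y, exists n, A ((x n)^-1 * y).
Proof.
move=> [A1 AM AV] oA; have [_ _ _ /(@second_countable_separable _ 1) [x xP]] := tdG.
exists x => y; have [|n An] := xP [set z | A (y^-1 * z)] (lcoset_open y oA).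
  by exists y; rewrite /= mulVg.
by exists n; have := AV _ An; rewrite invgM invgK.
Qed.

(** If no [F n] had interior, there would be a decreasing sequence of nonempty compact open sets
    [K n] with [K n.+1] missing [F n]. Their complements would cover the compact set [K 0], hence
    one of them would, contradicting nonemptiness. *)
Lemma baire (F : nat -> set G) : (forall n, closed (F n)) ->
  (forall x, exists n, F n x) -> exists n (x : G), nbhs x (F n).
Proof.
have [hG tdisG lcG _] := tdG.
move=> clF Fcov; apply: contrapT => nF.
pose good (K : set G) := [/\ open K, compact K & K !=set0].
have step n K : good K -> exists K', good K' /\ K' `<=` K `\` F n.
  move=> [oK cK [x Kx]].
  have [y [Ky nFy]] : K `\` F n !=set0.
    apply/set0P/eqP; rewrite setD_eq0 => KF.
    apply: nF; exists n, x; apply: filterS (open_nbhs_nbhs (conj oK Kx)).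
    exact: KF.
  have [A [oA cA Ay AK]] : exists A, [/\ open A, compact A, A y & A `<=` K `\` F n].
    apply: compact_open_base => //; apply: open_nbhs_nbhs; split=> //.
    by apply: openI => //; exact: closed_openC.
  by exists A; split=> //; split=> //; exists y.
have [K0 gK0] : exists K, good K.
  have [V [[V1 _ _] oV cV _]] := tdlcsc_van_dantzig (@filterT _ (nbhs (1 : G)) _).
  by exists V; split=> //; exists 1.
(* The condition [good] sits inside the conclusion so that [s] is total; on bad sets its value is
   irrelevant. *)
have /choice [s sP] (p : nat * set G) :
    exists K', good p.2 -> good K' /\ K' `<=` p.2 `\` F p.1.
  have [/(step p.1) [K' ?]|] := pselect (good p.2); first by exists K'.
  by exists set0.
pose K := fix K n := if n is m.+1 then s (m, K m) else K0.
have gK n : good (K n).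
  by elim: n => [//|n IHn] /=; case: (sP (n, K n)).
have KS n : K n.+1 `<=` K n `\` F n.
  by case: (sP (n, K n)) => //=; exact: gK.
have [n /(_ _) KC] : exists n, K0 `<=` ~` K n.
  apply: compact_increasing_cover.
  - by case: gK0.
  - move=> n; apply: closed_openC; apply: compact_closed => //.
    by case: (gK n).
  - by move=> n; apply: subsetC => x /KS [].
  - move=> x _; have [n Fx] := Fcov x.
    by exists n.+1 => // /KS [].
have KK0 m : K m `<=` K0.
  by elim: m => [//|m IHm] x /KS [/IHm].
have [_ _ [x Kx]] := gK n.
exact: (KC x (KK0 n x Kx)).
Qed.

(** The labelling [f] witnesses that [A] has countably many right cosets. They are closed, so by
    Baire one has interior, and translation carries this to [A]. *)
Lemma countable_index_open A (f : G -> nat) : is_subgroup A -> closed A ->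
  (forall x y, f x = f y -> A (x * y^-1)) -> open A.
Proof.
move=> sA clA fA.
(* A representative of the label [n], or [1] if the label is not attained. *)
pose r n := xget 1 (f @^-1` [set n]).
have [|x|n [x xA]] := @baire (fun n => [set x | A (x * (r n)^-1)]).
- move=> n; apply: preimage_closed => // ? _; exact: mulgr_continuous.
- exists (f x); apply: fA; rewrite /r; case: xgetP => [y _ //|/(_ x)] //=.
- have xA' : nbhs (x * (r n)^-1) A; last exact: (subgroup_open sA xA').
  have : nbhs (x * (r n)^-1) ((fun y => y * r n) @^-1` [set y | A (y * (r n)^-1)]).
    by apply: mulgr_continuous; rewrite mulgVK.
  by apply: filterS => z; rewrite /= mulgK.
Qed.

End Tdlcsc.

(** * Topological embeddings *)

Section Embedding.

Definition embedding (T1 T2 : topologicalType) (j : T1 -> T2) :=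
  [/\ injective j, continuous j &
      forall A, open A -> exists2 B, open B & A = j @^-1` B].

Variables (T1 T2 : topologicalType) (j : T1 -> T2).
Hypothesis ej : embedding j.

Lemma embedding_continuous (T : topologicalType) (f : T -> T1) :
  continuous (j \o f) -> continuous f.
Proof.
have [_ _ jo] := ej; move=> /continuousP cjf; apply/continuousP => A /jo [B oB ->].
exact: (cjf B).
Qed.

Lemma embedding_compact (A : set T1) : compact (j @` A) -> compact A.
Proof.
have [jI cj jo] := ej; move=> cjA F FF FA.
have FjA S : F S -> F (j @^-1` (j @` S)) by apply: filterS => x Sx; exists x.
have [_ [[a Aa <-] cla]] := cjA (j @ F) _ (FjA A FA).
exists a; split=> // S N FS; rewrite nbhsE => -[O [/jo [B oB ->] Ba] BN].
have [_ [[x Sx <-] Bx]] := cla (j @` S) B (FjA S FS) (open_nbhs_nbhs (conj oB Ba)).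
by exists x; split=> //; exact: BN.
Qed.

Lemma embedding_preimage_compact (A : set T2) : closed (range j) ->
  compact A -> compact (j @^-1` A).
Proof.
move=> clj cA; apply: embedding_compact.
have -> : j @` (j @^-1` A) = A `&` range j; last exact: compact_closedI.
apply/seteqP; split=> [_ [x Ax <-]|y [Ay [x _ xy]]]; first by split=> //; exists x.
by exists x => //=; rewrite xy.
Qed.

End Embedding.

(** Each property is pulled back along [j]; closedness of the range serves local compactness, where
    compact sets are pulled back. *)
Lemma tdlcsc_embedding (G G' : topologicalGroupType) (j : G' -> G) :
  tdlcsc G -> embedding j -> closed (range j) -> tdlcsc G'.
Proof.
move=> [hG tdG lcG [B cB [oB Bb]]] ej clj; have [jI cj jo] := ej; split.
- move=> x y cl; apply: jI; apply: hG => U V jU jV.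
  by have [z [Uz Vz]] := cl _ _ (cj x U jU) (cj y V jV); exists (j z).
- move=> x _; apply/seteqP; split=> [y [C [Cx _ cC] Cy]|_ ->]; last first.
    exact: connected_component_refl.
  apply: jI; suff : connected_component setT (j x) (j y) by rewrite tdG.
  apply: (@connected_component_max _ setT (j @` C) (j x)) => //.
  by apply: connected_continuous_connected => //; exact: continuous_subspaceT.
- move=> x _; have [K xK [cK clK]] := lcG (j x) I.
  have jK : nbhs (j x) K by move: xK; rewrite within_interior ?interiorT.
  exists (j @^-1` K); first by rewrite within_interior ?interiorT//; exact: cj.
  split; first exact: embedding_preimage_compact.
  by apply: preimage_closed => // ? _; exact: cj.
- exists [set j @^-1` b | b in B]; first exact: (card_le_trans (card_image_le _ _) cB).
  split=> [_ [b Bb' <-]|x A]; first by have /continuousP := cj; apply; exact: oB.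
  rewrite nbhsE => -[_ [/jo [O oO ->] Ox] OA].
  have [b [Bb' bx] bO] := Bb (j x) O (open_nbhs_nbhs (conj oO Ox)).
  exists (j @^-1` b); first by split=> //; exists b.
  by move=> y /bO; exact: OA.
Qed.

(** * Quotients by closed normal subgroups *)

Section Quotients.
Variables (G : topologicalGroupType) (N : normal_subgroup G).
Hypothesis clN : closed (N : set G).

Lemma quotient_hausdorff : hausdorff_space (quotient_group N).
Proof.
move=> u v; rewrite -(coset_reprK u) -(coset_reprK v).
move: (repr u) (repr v) => x y cl; apply/coset_eqP; apply: contrapT => nNxy.
have cdiv : continuous (fun p : G * G => p.1^-1 * p.2).
  apply: continuous_mulg; last by move=> p; exact: cvg_snd.
  by apply: continuous_invg => p; exact: cvg_fst.
have : nbhs (x, y) [set p : G * G | ~ (N : set G) (p.1^-1 * p.2)].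
  by apply: (cdiv (x, y) (~` (N : set G))); apply: open_nbhs_nbhs;
    split=> //; exact: closed_openC.
case=> [[A B] /= []]; rewrite nbhsE => -[A' [oA A'x] A'A].
rewrite nbhsE => -[B' [oB B'y] B'B] AB.
have [] := cl (@coset _ N @` A') (@coset _ N @` B').
- by apply: open_nbhs_nbhs; split; [exact: coset_open|exists x].
- by apply: open_nbhs_nbhs; split; [exact: coset_open|exists y].
move=> _ [[a A'a <-] [b B'b /esym/coset_eqP]].
by apply: (AB (a, b)); split; [exact: A'A|exact: B'B].
Qed.

Lemma coset_compact (K : set G) : compact K -> compact (@coset _ N @` K).
Proof.
by move=> cK; apply: continuous_compact => //; apply: continuous_subspaceT;
  exact: coset_continuous.
Qed.

Lemma coset_mul_preimage (K : set G) :
  [set x * y | x in N & y in K] = @coset _ N @^-1` (@coset _ N @` K).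
Proof.
apply/seteqP; split=> [_ [x Nx [y Ky <-]]|g [y Ky /coset_eqP Nyg]] /=.
  exists y => //; apply/coset_eqP; exact: (normalJ y Nx).
exists (g * y^-1); last by exists y => //; rewrite mulgVK.
by have := normalJ y^-1 Nyg; rewrite conjgE invgK !gnorm.
Qed.

(** The product is the preimage of the image of [K] in the quotient, which is compact in a Hausdorff
    space. *)
Lemma closed_mul_compact (K : set G) :
  compact K -> closed [set x * y | x in N & y in K].
Proof.
move=> cK; rewrite coset_mul_preimage.
apply: preimage_closed => [? _|]; first exact: coset_continuous.
apply: compact_closed; first exact: quotient_hausdorff.
exact: coset_compact.
Qed.

Lemma quotient_profinite (K : set G) :
  totally_disconnected [set: G] -> locally_compact [set: G] -> hausdorff_space G ->
  compact K -> [set x * y | x in N & y in K] = setT ->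
  profinite (quotient_group N).
Proof.
move=> tdG lcG hG cK NK; split; first exact: quotient_hausdorff.
- apply: zero_dimension_totally_disconnected => u v.
  rewrite -(coset_reprK u) -(coset_reprK v); move: (repr u) (repr v) => x y.
  move=> /eqP xy.
  (* A compact open subgroup [V] in this neighbourhood makes the image of [x V] a clopen set
     containing the coset of [x] but not that of [y]: open since [coset] is an open map, closed
     since it is compact. *)
  have : nbhs 1 [set g : G | ~ (N : set G) (g^-1 * (x^-1 * y))].
    have cdiv : continuous (fun g : G => g^-1 * (x^-1 * y)).
      apply: continuous_mulg; last by move=> p; exact: cvg_cst.
      exact: invg_continuous.
    apply: (cdiv 1 (~` (N : set G))); apply: open_nbhs_nbhs; split; first exact: closed_openC.
    by rewrite /= invg1 mul1g => /coset_eqP.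
  move=> /(van_dantzig hG tdG lcG) [V [[V1 _ _] oV cV VN]].
  exists (@coset _ N @` [set x * g | g in V]); split.
  + split; last first.
      apply: compact_closed; first exact: quotient_hausdorff.
      by apply: coset_compact; exact: compact_lcoset.
    apply: coset_open; rewrite (_ : [set x * g | g in V] = [set g | V (x^-1 * g)]).
      exact: lcoset_open.
    apply/seteqP; split=> [_ [g Vg <-]|g Vg]; first by rewrite /= mulKg.
    by exists (x^-1 * g) => //; rewrite mulVKg.
  + by exists x => //; exists 1 => //; rewrite mulg1.
  + move=> [_ [g Vg <-] /coset_eqP]; rewrite invgM -mulgA; exact: VN.
- have -> : [set: quotient_group N] = @coset _ N @` K; last exact: coset_compact.
  apply/seteqP; split=> // u _; rewrite -(coset_reprK u).
  have : [set x * y | x in N & y in K] (repr u) by rewrite NK.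
  by rewrite coset_mul_preimage.
Qed.

End Quotients.

Lemma quotient_discrete (G : topologicalGroupType) (N : normal_subgroup G) :
  open (N : set G) -> discrete_space (quotient_group N).
Proof.
move=> oN A; rewrite /open /= /quotient_open openE => x Ax; rewrite /interior.
apply: filterS (open_nbhs_nbhs (conj (lcoset_open x oN) _)).
  by move=> y /coset_eqP xy; change (A (coset N y)); rewrite -xy.
by rewrite /= mulVg; exact: normal1.
Qed.

(** * Residually discrete groups *)

Section ResiduallyDiscrete.

Definition open_normal (G : topologicalGroupType) (W : set G) :=
  is_normal_subgroup W /\ open W.

Definition residually_discrete (G : topologicalGroupType) :=
  forall x : G, x <> 1 -> exists2 W, open_normal W & ~ W x.

Lemma discrete_residually_discrete (G : topologicalGroupType) :
  discrete_space G -> residually_discrete G.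
Proof.
move=> dG x x1; exists [set 1] => //; split; last exact: dG.
split; first by split=> [//|_ _ -> ->|_ ->]; rewrite ?mulg1 ?invg1.
by move=> _ g ->; rewrite conj1g.
Qed.

(** The intersection of all conjugates of an open subgroup [V] avoiding [x] is normal, and it is
    open by the tube lemma over the compact space [G]. *)
Lemma profinite_residually_discrete (G : topologicalGroupType) :
  profinite G -> residually_discrete G.
Proof.
move=> [hG tdG cG] x x1.
have lcG : locally_compact [set: G].
  by move=> y _; exists setT; [exact: filterT|split=> //; exact: closedT].
have [|V [sV oV cV Vx]] := van_dantzig (N := ~` [set x]) hG tdG lcG.
  apply: open_nbhs_nbhs; split; last exact/nesym.
  by apply: closed_openC; apply: compact_closed => //; exact: compact_set1.
have [V1 VM VV] := sV.
exists [set g | forall p, V (g ^ p)]; last by move=> /(_ 1); rewrite conjg1 => /Vx; apply.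
have sC : is_subgroup [set g | forall p, V (g ^ p)].
  split=> [p|g h Vg Vh p|g Vg p] /=; rewrite ?conj1g ?conjMg ?conjVg //.
    by apply: VM; [exact: Vg|exact: Vh].
  by apply: VV; exact: Vg.
split; first by split=> // g h Vg p; rewrite -conjgM.
apply: (subgroup_open sC (x := 1)).
have := @tube_lemma _ _ (fun p : G * G => p.2 ^ p.1) setT V.
move=> /(_ _ oV cG) T1; apply: filterS (T1 _ _) => [g gV p|p|p _ /=].
- exact: gV.
- by apply: continuous_conjg => q; [exact: cvg_snd|exact: cvg_fst].
- by rewrite conj1g.
Qed.

End ResiduallyDiscrete.

(** * Embedded subgroups, cocompact extensions and compact open exhaustions *)

Lemma subgroup_val_embedding (G : topologicalGroupType) (A : subgroup G) :
  embedding (val : subgroup_type A -> G).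
Proof.
split; [exact: val_inj|exact: subgroup_val_continuous|].
by move=> _ [B oB <-]; exists B.
Qed.

Lemma subgroup_val_morph (G : topologicalGroupType) (A : subgroup G) :
  {morph (val : subgroup_type A -> G) : x y / x * y}.
Proof. exact: gmulfM. Qed.

Lemma range_subgroup_val (G : topologicalGroupType) (A : subgroup G) :
  range (val : subgroup_type A -> G) = A.
Proof.
apply/seteqP; split=> [_ [x _ <-]|x Ax]; first exact: set_valP.
by exists (exist _ x (mem_set Ax)).
Qed.

Lemma embedding_comp (T1 T2 T3 : topologicalType) (f : T1 -> T2) (g : T2 -> T3) :
  embedding f -> embedding g -> embedding (g \o f).
Proof.
move=> [fI cf fo] [gI cg go]; split; first exact: inj_comp.
- by move=> x; apply: continuous_comp; [exact: cf|exact: cg].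
- by move=> A /fo [B /go [C oC ->] ->]; exists C.
Qed.

(** Quantifying over all groups embedded onto [A] allows for subgroups of subgroups without
    transporting [elementary] along isomorphisms. *)
Definition elementary_subset (G : topologicalGroupType) (A : set G) :=
  forall (G' : topologicalGroupType) (j : G' -> G), embedding j ->
  {morph j : x y / x * y} -> range j = A -> elementary G'.

(** Since [B] lies in [A K] with [K] compact, the quotient of [B] by [A] is profinite, and the
    extension constructor applies. *)
Lemma elementary_cocompact (G : topologicalGroupType) (A K : set G) (B : subgroup G) :
  tdlcsc G -> is_subgroup A -> closed A -> closed (B : set G) -> A `<=` B ->
  (forall x g, A x -> (B : set G) g -> A (x ^ g)) ->
  compact K -> B `<=` [set x * y | x in A & y in K] ->
  elementary_subset A -> elementary (subgroup_type B).
Proof.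
move=> tG sA clA clB AB AJ cK BAK eA.
pose v : subgroup_type B -> G := val.
have ev : embedding v := @subgroup_val_embedding G B.
have vM : {morph v : x y / x * y} := @subgroup_val_morph G B.
have rv : range v = B := @range_subgroup_val G B.
have tB : tdlcsc (subgroup_type B) by apply: (tdlcsc_embedding tG ev); rewrite rv.
have sN : is_subgroup (v @^-1` A) by exact: preimage_subgroup.
have nN : is_normal_subgroup (Subgroup sN).
  split=> // x g Ax; rewrite /= /preimage /= (morph_mulgJ vM); apply: AJ => //.
  by rewrite -rv; exists g.
pose N := NormalSubgroup nN.
have clN : closed (N : set (subgroup_type B)).
  by apply: preimage_closed => // ? _; case: ev.
pose w : subgroup_type N -> subgroup_type B := val.
have rw : range w = N := @range_subgroup_val _ N.
apply: (@elementary_extension _ N) => //.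
  apply: (eA (subgroup_type N) (v \o w)).
  - by apply: embedding_comp => //; exact: subgroup_val_embedding.
  - by move=> x y /=; rewrite -vM.
  - apply/seteqP; split=> [_ [x _ <-]|x Ax].
      by have : range w (w x) by []; rewrite rw.
    have : range v x by rewrite rv; exact: AB.
    move=> [y _ yx]; have : range w y by rewrite rw /= /preimage /= yx.
    by move=> [z _ zy]; exists z => //=; rewrite zy.
left; have [hB tdB lcB _] := tB.
apply: (quotient_profinite clN (K := v @^-1` K)) => //.
  by apply: embedding_preimage_compact => //; rewrite rv.
apply/seteqP; split=> // b _.
have : (B : set G) (v b) by rewrite -rv; exists b.
move=> /BAK [x Ax [y Ky xyb]].
have [x' _ xx'] : range v x by rewrite rv; exact: AB.
(* The factor in [K] lies in [B] too, being the quotient of two elements of [B]. *)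
exists x'; first by rewrite /= /preimage /= xx'.
exists (x'^-1 * b); last by rewrite mulVKg.
by rewrite /preimage /= vM (morph_mulgV vM) xx' -xyb mulKg.
Qed.

Lemma elementary_tdlcsc (G : topologicalGroupType) : elementary G -> tdlcsc G.
Proof.
case=> {}G //.
  move=> [hG tdG cG] scG; split=> // y _.
  by exists setT; [exact: filterT|split=> //; exact: closedT].
move=> dG cG; have dC (A : set G) : closed A by rewrite -openC; exact: dG.
have xx (x : G) : nbhs x [set x] by apply: open_nbhs_nbhs; split=> //; exact: dG.
split.
- by move=> x y cl; have [z [-> ->]] := cl _ _ (xx x) (xx y).
- apply: zero_dimension_totally_disconnected => x y /eqP xy.
  by exists [set x]; split; [split; [exact: dG|exact: dC]|by []|exact/nesym].
- move=> x _; exists [set x]; first by rewrite within_interior ?interiorT.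
  by split; [exact: compact_set1|exact: dC].
- exists [set [set x] | x in [set: G]]; first exact: card_le_trans (card_image_le _ _) cG.
  split=> [A _|x A /nbhs_singleton Ax]; first exact: dG.
  by exists [set x]; [split=> //; exists x|move=> _ ->].
Qed.

(** Finite unions of left cosets of a compact open subgroup, along an enumeration of its cosets. *)
Lemma compact_open_exhaustion (G : topologicalGroupType) : tdlcsc G ->
  exists F : nat -> set G, [/\ forall n, open (F n), forall n, compact (F n),
    forall n, F n `<=` F n.+1, forall n, F n !=set0 & \bigcup_n F n = setT].
Proof.
move=> tG; have [V [sV oV cV _]] := tdlcsc_van_dantzig tG (@filterT _ (nbhs (1 : G)) _).
have [r rP] := countable_cosets tG sV oV.
pose F n := [set y | exists2 j, (j <= n)%N & V ((r j)^-1 * y)].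
have FS n : F n `<=` F n.+1 by move=> y [j jn Vy]; exists j => //; exact: leqW.
have cC n : compact [set y | V ((r n)^-1 * y)].
  rewrite (_ : mkset _ = [set r n * v | v in V]); first exact: compact_lcoset.
  apply/seteqP; split=> [y Vy|_ [v Vv <-]]; last by rewrite /= mulKg.
  by exists ((r n)^-1 * y) => //; rewrite mulVKg.
exists F; split=> //.
- move=> n; rewrite (_ : F n =
    \bigcup_(j in [set j | (j <= n)%N]) [set y | V ((r j)^-1 * y)]) //.
  by apply: bigcup_open => j _; exact: lcoset_open.
- elim=> [|n IHn].
    rewrite (_ : F 0 = [set y | V ((r 0)^-1 * y)])//; apply/seteqP; split=> y.
      by move=> [j]; rewrite leqn0 => /eqP ->.
    by exists 0%N.
  rewrite (_ : F n.+1 = F n `|` [set y | V ((r n.+1)^-1 * y)]); first exact: compactU.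
  apply/seteqP; split=> y; last by move=> [/FS//|Vy]; exists n.+1.
  move=> [j]; rewrite leq_eqVlt => /orP[/eqP -> Vy|jn Vy]; first by right.
  by left; exists j.
- move=> n; exists (r 0%N), 0%N => //.
  by rewrite mulVg; case: sV.
- by apply/seteqP; split=> // y _; have [n Vy] := rP y; exists n => //; exists n.
Qed.

Lemma morph_continuous (G H : topologicalGroupType) (f : G -> H) :
  tdlcsc H -> {morph f : x y / x * y} ->
  (forall V, is_subgroup V -> open V -> compact V -> open (f @^-1` V)) ->
  continuous f.
Proof.
move=> tH fM fV x A fxA.
have A1 : nbhs (1 : H) [set y | A (f x * y)].
  by apply: (mulgl_continuous (x := f x)); rewrite mulg1.
have [V [sV oV cV VA]] := tdlcsc_van_dantzig tH A1.
apply: filterS (open_nbhs_nbhs (conj (lcoset_open x (fV V sV oV cV)) _)).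
  by move=> y /VA /=; rewrite fM (morph_mulgV fM) mulVKg.
by case: sV => V1 _ _; rewrite /= mulVg (morph_mulg1 fM).
Qed.

(** * Dense normal images and the conjugation action *)

Definition normal_compression (L G : topologicalGroupType) (psi : L -> G) :=
  [/\ continuous psi, {morph psi : x y / x * y}, injective psi,
      forall x g, range psi (psi x ^ g) & dense (range psi)].

Section ConjugationAction.
Variables (L G : topologicalGroupType) (psi : L -> G).
Hypotheses (tL : tdlcsc L) (tG : tdlcsc G) (npsi : normal_compression psi).

Let cpsi : continuous psi. Proof. by case: npsi. Qed.
Let psiM : {morph psi : x y / x * y}. Proof. by case: npsi. Qed.
Let psiI : injective psi. Proof. by case: npsi. Qed.

(** The conjugation of [G] on the image of [psi], pulled back to a right action on [L]. Normality of
    the range ensures that the default [1] is never forced. *)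
Definition conj_act (g : G) (x : L) : L := xget 1 [set y | psi y = psi x ^ g].
Local Notation act := conj_act.

Lemma conj_actE g x : psi (act g x) = psi x ^ g.
Proof.
have [_ _ _ /(_ x g) [y _ yx] _] := npsi.
by apply: (xgetPex 1 (P := [set y | psi y = psi x ^ g])); exists y.
Qed.

Lemma conj_actM g : {morph act g : x y / x * y}.
Proof. by move=> x y; apply: psiI; rewrite psiM !conj_actE psiM conjMg. Qed.

Lemma conj_act_mul g h x : act (g * h) x = act h (act g x).
Proof. by apply: psiI; rewrite !conj_actE conjgM. Qed.

Lemma conj_act1 x : act 1 x = x.
Proof. by apply: psiI; rewrite conj_actE conjg1. Qed.

Lemma psi_compact_closed (K : set L) : compact K -> closed (psi @` K).
Proof.
move=> cK; apply: compact_closed; first by case: tG.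
by apply: continuous_compact => //; exact: continuous_subspaceT.
Qed.

Lemma mem_image_psi (K : set L) x : (psi @` K) (psi x) = K x.
Proof.
by apply/propext; split=> [[y Ky /psiI <-]|Kx] //; exists x.
Qed.

(** The preimage of a compact open subgroup [V] has countable index, as [V] has. It is also closed,
    being the preimage of the compact set [psi(V)] under the continuous map sending [x] to
    [psi x ^ g]. Hence it is open. *)
Lemma conj_act_continuous g : continuous (act g).
Proof.
apply: morph_continuous => //; first exact: conj_actM.
move=> V sV oV cV; have [V1 VM VV] := sV.
have [r rP] := countable_cosets tL sV oV.
(* The inverse turns left cosets into the right cosets expected by [countable_index_open]. *)
have /choice [f fP] : forall x, exists n, V ((r n)^-1 * (act g x)^-1).
  by move=> x; exact: rP.
apply: (countable_index_open tL (f := f)).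
- by apply: preimage_subgroup => //; exact: conj_actM.
- rewrite (_ : _ @^-1` _ = (fun x => psi x ^ g) @^-1` (psi @` V)).
    apply: preimage_closed; last exact: psi_compact_closed.
    by move=> x _; apply: (@continuous_comp _ _ _ psi (fun y => y ^ g));
      [exact: cpsi|exact: conjgl_continuous].
  by apply/funext => x; rewrite -[RHS]/((psi @` V) (psi x ^ g)) -conj_actE mem_image_psi.
- move=> x y fxy; rewrite /preimage /= conj_actM (morph_mulgV (@conj_actM g)).
  have := fP y; rewrite -fxy => /(VM _ _ (VV _ (fP x))).
  by rewrite !gnorm.
Qed.

(** The closed sets [A n] of elements moving [K] into [F n] cover [G], so some [A n] has an interior
    point [g0]. Its right translates give neighbourhoods of all points of [C], on each of which [K]
    moves inside one compact set. *)
Lemma conj_act_bounded (C : set G) (K : set L) : compact C -> compact K ->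
  exists2 K', compact K' & forall g x, C g -> K x -> K' (act g x).
Proof.
move=> cC cK; have [F [oF cF FS _ Fcov]] := compact_open_exhaustion tL.
pose A n := [set g | forall x, K x -> F n (act g x)].
have clA n : closed (A n).
  rewrite (_ : A n = \bigcap_(x in K) ((fun g => psi x ^ g) @^-1` (psi @` F n))).
    apply: closed_bigI => x _; apply: preimage_closed; last exact: psi_compact_closed.
    by move=> ? _; exact: conjgr_continuous.
  have FE x g : (psi @` F n) (psi x ^ g) = F n (act g x).
    by rewrite -conj_actE mem_image_psi.
  by apply/seteqP; split=> g Ag x Kx;
    [rewrite /preimage /mkset FE|rewrite -FE]; exact: Ag.
have [|n [g0 Ag0]] := baire tG clA.
  move=> g; have cgK : compact (act g @` K).
    apply: continuous_compact => //; apply: continuous_subspaceT.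
    exact: conj_act_continuous.
  have [|n Fn] := compact_increasing_cover cgK oF FS; first by rewrite Fcov.
  by exists n => x Kx; apply: Fn; exists x.
apply: (compact_ind (P := fun C => exists2 K', compact K' &
  forall g x, C g -> K x -> K' (act g x)) cC).
- by exists set0 => //; exact: compact0.
- move=> C1 C2 [K1 cK1 CK1] [K2 cK2 CK2]; exists (K1 `|` K2); first exact: compactU.
  by move=> g x [C1g|C2g] Kx; [left; exact: CK1|right; exact: CK2].
- by move=> C1 C2 C12 [K' cK' CK']; exists K' => // g x /C12; exact: CK'.
- move=> h _; exists ((fun g => g * (h^-1 * g0)) @^-1` A n).
    by apply: mulgr_continuous; rewrite mulVKg.
  exists (act (g0^-1 * h) @` F n).
    apply: continuous_compact => //; apply: continuous_subspaceT.
    exact: conj_act_continuous.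
  move=> g x Ag Kx; exists (act (g * (h^-1 * g0)) x); first exact: Ag.
  by rewrite -conj_act_mul !gnorm.
Qed.

End ConjugationAction.

(** * Reduction to compactly generated groups *)

Definition compactly_generated (G : topologicalGroupType) :=
  exists2 K : set G, compact K & generated K = setT.

Lemma range_comp (X Y Z : Type) (f : X -> Y) (g : Y -> Z) A :
  range f = A -> range (g \o f) = g @` A.
Proof. by move=> <-; rewrite image_comp. Qed.

Lemma corestriction (X G G' : topologicalGroupType) (f : X -> G) (j : G' -> G) :
  embedding j -> {morph j : x y / x * y} ->
  continuous f -> {morph f : x y / x * y} -> range f `<=` range j ->
  exists f' : X -> G', [/\ continuous f', {morph f' : x y / x * y} & j \o f' = f].
Proof.
move=> ej jM cf fM fj; have [jI _ _] := ej.
have /choice [f' f'P] : forall x, exists y, j y = f x.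
  by move=> x; have [|y _ yx] := fj (f x); [exists x|exists y].
have jf : j \o f' = f by apply/funext.
exists f'; split=> //; first by apply: (embedding_continuous ej); rewrite jf.
by move=> x y; apply: jI; rewrite jM !f'P fM.
Qed.

(** Used to restrict [psi] to a subgroup of [L], with the closure of its image as new target. *)
Lemma normal_compression_closure (X G G' : topologicalGroupType) (f : X -> G)
    (j : G' -> G) :
  embedding j -> {morph j : x y / x * y} ->
  continuous f -> {morph f : x y / x * y} -> injective f ->
  range j = closure (range f) ->
  (forall x g, closure (range f) g -> range f (f x ^ g)) ->
  exists f' : X -> G', normal_compression f'.
Proof.
move=> ej jM cf fM fI rj fJ; have [jI cj jo] := ej.
have [|f' [cf' f'M jf]] := corestriction ej jM cf fM.
  by rewrite rj; exact: subset_closure.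
have jfE x : j (f' x) = f x by rewrite -jf.
exists f'; split=> //.
- by move=> x y xy; apply: fI; rewrite -!jfE xy.
- move=> x g; have [|y _ yx] := fJ x (j g); first by rewrite -rj; exists g.
  by exists y => //; apply: jI; rewrite (morph_mulgJ jM) !jfE.
- move=> U [y Uy] /jo [B oB UB]; have : closure (range f) (j y).
    by rewrite -rj; exists y.
  move=> /(_ B) [|_ [[x _ <-] Bx]].
    by apply: open_nbhs_nbhs; split=> //; move: Uy; rewrite UB.
  by exists (f' x); split; [rewrite UB /preimage /= jfE|exists x].
Qed.

(** The predicate [P] is [compactly_generated] before the reduction and trivial after it. *)
Definition compression_elementary (P : topologicalGroupType -> Prop)
    (H : topologicalGroupType) :=
  forall (L G : topologicalGroupType) (i : L -> H) (psi : L -> G),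
  P L -> tdlcsc L -> tdlcsc G ->
  continuous i -> {morph i : x y / x * y} -> injective i ->
  normal_compression psi -> elementary G.

Lemma generated_preimage_sub (G H : groupType) (f : G -> H) (S : set G) (A : set H) :
  {morph f : x y / x * y} -> is_subgroup A -> (forall x, S x -> A (f x)) ->
  forall x, generated S x -> A (f x).
Proof.
move=> fM sA SA x; apply: (smallest_sub (X := f @^-1` A)) => //.
exact: preimage_subgroup.
Qed.

(** The generating set [S] need not be compact; it is enlarged to the trace of [K] on [A], which is
    compact because [A] is closed. *)
Lemma compactly_generated_subgroup (G : topologicalGroupType) (A : subgroup G)
    (S K : set G) :
  closed (A : set G) -> compact K -> S `<=` K -> generated S = A ->
  compactly_generated (subgroup_type A).
Proof.
move=> clA cK SK SA; pose v : subgroup_type A -> G := val.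
have ev : embedding v := @subgroup_val_embedding G A.
have vM : {morph v : x y / x * y} := @subgroup_val_morph G A.
have rv : range v = A := @range_subgroup_val G A.
have [vI _ _] := ev.
exists (v @^-1` K); first by apply: embedding_preimage_compact; rewrite ?rv.
apply/seteqP; split=> // x _.
have sub : A `<=` v @` generated (v @^-1` K).
  rewrite -SA; apply: smallest_sub; first exact/image_subgroup/generated_subgroup.
  move=> y Sy; have : range v y by rewrite rv -SA; exact: sub_gen_smallest.
  move=> [z _ zy]; exists z => //; apply: sub_gen_smallest.
  by rewrite /preimage /= zy; exact: SK.
have [|z gz /vI <- //] := sub (v x).
by rewrite -rv; exists x.
Qed.

Section Reduction.
Variables (H L G : topologicalGroupType) (i : L -> H) (psi : L -> G).
Hypotheses (tL : tdlcsc L) (tG : tdlcsc G).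
Hypotheses (ci : continuous i) (iM : {morph i : x y / x * y}) (iI : injective i).
Hypothesis npsi : normal_compression psi.
Hypothesis Hcg : compression_elementary compactly_generated H.

Local Notation act := (conj_act psi).

Lemma elementary_mul_part (U : set G) (O S K : set L) :
  is_subgroup U -> open U -> compact U ->
  generated S = O -> open O -> compact K -> S `<=` K ->
  (forall u x, U u -> O x -> O (act u x)) ->
  forall sOU : is_subgroup [set x * u | x in psi @` O & u in U],
  elementary (subgroup_type (Subgroup sOU)).
Proof.
move=> sU oU cU SO oO cK SK OU sOU; have [U1 _ _] := sU.
have [cpsi psiM psiI psiJ dpsi] := npsi.
have sO : is_subgroup O by rewrite -SO; exact: generated_subgroup.
have [O1 _ _] := sO.
have UOU : U `<=` [set x * u | x in psi @` O & u in U].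
  by move=> u Uu; exists 1; [exists 1 => //; exact: morph_mulg1|exists u; rewrite ?mul1g].
have clOU : closed [set x * u | x in psi @` O & u in U].
  apply: open_subgroup_closed => //; apply: (subgroup_open sOU (x := 1)).
  by apply: filterS UOU _; apply: open_nbhs_nbhs.
have OOU : psi @` O `<=` [set x * u | x in psi @` O & u in U].
  by move=> x Ox; exists x => //; exists 1 => //; rewrite mulg1.
(* An open subgroup is closed, so [psi(O) U] contains this closure; as it normalises [psi(O)], so
   does the closure. *)
have clOOU : closure (psi @` O) `<=` [set x * u | x in psi @` O & u in U].
  by move=> x /(closureS OOU) /clOU.
have OJ x g : (psi @` O) x -> [set x * u | x in psi @` O & u in U] g ->
    (psi @` O) (x ^ g).
  move=> [y Oy <-] [_ [z Oz <-] [u Uu <-]].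
  rewrite conjgM -(morph_mulgJ psiM) -(conj_actE npsi); exists (act u (y ^ z)) => //.
  by apply: OU => //; exact: subgroup_conj.
apply: (elementary_cocompact (A := closure (psi @` O)) (K := U)) => //.
- exact/closure_subgroup/image_subgroup.
- exact: closed_closure.
- by move=> x g Ax Og; apply: closure_conj Ax => y Oy; exact: OJ.
- by move=> _ [x Ox [u Uu <-]]; exists x; [exact: subset_closure|exists u].
move=> G' j ej jM rj.
have clO : closed O by exact: open_subgroup_closed.
pose v : subgroup_type (Subgroup sO) -> L := val.
have ev : embedding v := @subgroup_val_embedding L (Subgroup sO).
have vM : {morph v : x y / x * y} := @subgroup_val_morph L (Subgroup sO).
have rv : range v = O := @range_subgroup_val L (Subgroup sO).
have [vI cv _] := ev.
have rpv : range (psi \o v) = psi @` O by exact: range_comp.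
have [|||||f' nf'] := @normal_compression_closure _ _ _ (psi \o v) j ej jM.
- by move=> x; apply: continuous_comp; [exact: cv|exact: cpsi].
- by move=> x y /=; rewrite vM psiM.
- exact: inj_comp.
- by rewrite rpv.
- move=> x g; rewrite rpv => /clOOU OUg; apply: OJ => //.
  by rewrite -rpv; exists x.
apply: (Hcg (i := i \o v) (psi := f')) => //.
- exact: (@compactly_generated_subgroup L (Subgroup sO) S K).
- by apply: (tdlcsc_embedding tL ev); rewrite rv.
- by apply: (tdlcsc_embedding tG ej); rewrite rj; exact: closed_closure.
- by move=> x; apply: continuous_comp; [exact: cv|exact: ci].
- by move=> x y /=; rewrite vM iM.
- exact: inj_comp.
Qed.

Lemma elementary_of_compactly_generated : elementary G.
Proof.
have [cpsi psiM psiI psiJ dpsi] := npsi.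
have [U [sU oU cU _]] := tdlcsc_van_dantzig tG (@filterT _ (nbhs (1 : G)) _).
have [F [oF cF FS F0 Fcov]] := compact_open_exhaustion tL.
have [U1 UM UV] := sU.
(* Generating by all [U]-translates of [F n] makes [O n] invariant under [U]; these translates stay
   in a compact set by [conj_act_bounded]. *)
pose S n := [set act u x | u in U & x in F n].
pose O n := generated (S n).
have sO n : is_subgroup (O n) by exact: generated_subgroup.
have FO n : F n `<=` O n.
  move=> x Fx; apply: sub_gen_smallest; exists 1 => //; exists x => //.
  exact: conj_act1.
have oO n : open (O n).
  have [x Fx] := F0 n; apply: (subgroup_open (sO n) (x := x)).
  by apply: filterS (FO n) _; apply: open_nbhs_nbhs.
have actO n u x : U u -> O n x -> O n (act u x).
  move=> Uu; apply: generated_preimage_sub => //; first exact: conj_actM.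
  move=> _ [w Uw [y Fy <-]]; apply: sub_gen_smallest; rewrite -(conj_act_mul npsi).
  by exists (w * u); [exact: UM|exists y].
have OS n : O n `<=` O n.+1.
  apply: sub_smallest2r; first exact: generated_subgroup.
  by move=> _ [u Uu [x Fx <-]]; exists u => //; exists x => //; exact: FS.
have sOU n : is_subgroup [set x * u | x in psi @` O n & u in U].
  apply: subgroup_mul => //; first exact: image_subgroup.
  move=> _ u [x Ox <-] Uu; rewrite -(conj_actE npsi).
  by exists (act u x) => //; exact: actO.
apply: (elementary_union (O := fun n => Subgroup (sOU n))) => //=.
- move=> n; apply: (subgroup_open (sOU n) (x := 1)).
  apply: filterS (open_nbhs1 sU oU) => u Uu.
  exists 1; last by exists u; rewrite ?mul1g.
  by exists 1; [case: (sO n)|exact: morph_mulg1].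
- move=> n _ [_ [x Ox <-] [u Uu <-]]; exists (psi x); last by exists u.
  by exists x => //; exact: OS.
- apply/seteqP; split=> // g _.
  (* Density puts a point of the image of [psi] in the open coset [g U], so [g] lies in
     [psi(L) U]. *)
  have [||y [/= Uyg [x _ xy]]] := dpsi [set y | U (y^-1 * g)].
  + by exists g; rewrite /= mulVg.
  + have cdiv : continuous (fun y : G => y^-1 * g).
      by apply: continuous_mulg; [exact: invg_continuous|move=> p; exact: cvg_cst].
    by move/continuousP: cdiv; exact.
  have : (\bigcup_n F n) x by rewrite Fcov.
  move=> [n _ Fx]; exists n => //; exists (psi x); first by exists x => //; exact: FO.
  by exists ((psi x)^-1 * g); [rewrite xy|rewrite mulVKg].
- move=> n; have [K cK KP] := conj_act_bounded tL tG npsi cU (cF n).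
  apply: (@elementary_mul_part U (O n) (S n) K) => //; last by move=> u x; exact: actO.
  by move=> _ [u Uu [x Fx <-]]; exact: KP.
Qed.

End Reduction.

(** * The discrete residual *)

Definition discrete_residual (G : topologicalGroupType) : set G :=
  \bigcap_(W in @open_normal G) W.
Arguments discrete_residual G : clear implicits.

Section DiscreteResidual.
Variable L : topologicalGroupType.
Local Notation R := (discrete_residual L).

Lemma discrete_residual_normal : is_normal_subgroup R.
Proof.
split; first by apply: subgroup_bigcap => W [[]].
by move=> x g Rx W oW; have [[_ WJ] _] := oW; apply: WJ; exact: Rx.
Qed.

Lemma discrete_residual_closed : closed R.
Proof. by apply: closed_bigI => W [[sW _] oW]; exact: open_subgroup_closed. Qed.

Lemma open_normalT : open_normal [set: L].
Proof. by split; [|exact: openT]. Qed.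

Lemma open_normalI (A B : set L) :
  open_normal A -> open_normal B -> open_normal (A `&` B).
Proof.
move=> [[sA AJ] oA] [[sB BJ] oB]; split; last exact: openI.
split; first exact: subgroupI.
by move=> x g [Ax Bx]; split; [exact: AJ|exact: BJ].
Qed.

Lemma open_normal_preimage (H : topologicalGroupType) (f : L -> H) (W : set H) :
  continuous f -> {morph f : x y / x * y} -> open_normal W -> open_normal (f @^-1` W).
Proof.
move=> cf fM [[sW WJ] oW]; split; last by move/continuousP: cf; exact.
split; first exact: preimage_subgroup.
by move=> x g; rewrite /preimage /= (morph_mulgJ fM); exact: WJ.
Qed.

Lemma discrete_residual_kernel (H : topologicalGroupType) (f : L -> H) x :
  residually_discrete H -> continuous f -> {morph f : x y / x * y} ->
  R x -> f x = 1.
Proof.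
move=> rH cf fM Rx; apply: contrapT => /rH [W oW]; apply.
exact: (Rx _ (open_normal_preimage cf fM oW)).
Qed.

(* Given a compact generating set [K], choose an open normal [W] so small that
   the conjugates of [V] by [K] meet [W] inside [R V]; then conjugation by
   elements of [K] preserves [W `&` R V]. *)
Lemma open_normal_in_residual_mul (K V : set L) :
  compact K -> generated K = setT ->
  is_subgroup V -> open V -> compact V ->
  exists2 W, open_normal W & R `<=` W /\ W `<=` [set r * v | r in R & v in V].
Proof.
move=> cK gK sV oV cV; have [V1 _ _] := sV.
have [sR RJ] := discrete_residual_normal; have [R1 _ _] := sR.
(* Inverses are added because the invariance under conjugation by [K] must also hold for
   inverses. *)
pose K' := K `|` [set x^-1 | x in K].
have cK' : compact K' by apply: compactU => //; exact: compact_inv.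
pose RV := [set r * v | r in R & v in V].
have sRV : is_subgroup RV by apply: subgroup_mul => // x g Rx _; exact: RJ.
have RRV : R `<=` RV by move=> r Rr; exists r => //; exists 1; rewrite ?mulg1.
have VRV : V `<=` RV by move=> v Vv; exists 1 => //; exists v; rewrite ?mul1g.
have oRV : open RV.
  apply: (subgroup_open sRV (x := 1)); exact: filterS VRV (open_nbhs1 sV oV).
have [W oW WRV] : exists2 W, open_normal W &
    W `&` [set v ^ k | v in V & k in K'] `<=` RV.
  apply: (compact_ind (P := fun A => exists2 W, open_normal W & W `&` A `<=` RV)
    (compact_conj cV cK')).
  - by exists setT; [exact: open_normalT|rewrite setI0].
  - move=> A B [W1 oW1 W1A] [W2 oW2 W2B]; exists (W1 `&` W2); first exact: open_normalI.
    by move=> x [[W1x W2x] [Ax|Bx]]; [exact: W1A|exact: W2B].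
  - by move=> A B AB [W oW WB]; exists W => // x [Wx /AB Bx]; exact: WB.
  - move=> x _; have [RVx|nRVx] := pselect (RV x).
      exists RV; first exact: open_nbhs_nbhs.
      by exists setT; [exact: open_normalT|move=> y []].
    (* A point outside [R V] is outside [R], so some open normal [W] misses it; [W] being closed, it
       misses a neighbourhood. *)
    have /existsNP [W /not_implyP [oW nWx]] : ~ R x by move=> /RRV.
    exists (~` W); last by exists W => // y [Wy /(_ Wy)].
    have [[sW _] opW] := oW; apply: open_nbhs_nbhs; split=> //.
    by apply: closed_openC; exact: open_subgroup_closed.
have [[sW WJ] opW] := oW; have [W1 WM WV] := sW.
have RW : R `<=` W by move=> x; apply.
have sX : is_subgroup (W `&` RV) by exact: subgroupI.
have XK k x : K' k -> (W `&` RV) x -> (W `&` RV) (x ^ k).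
  move=> Kk [Wx [r Rr [v Vv rvx]]]; split; first exact: WJ.
  have [_ RVM _] := sRV; rewrite -rvx conjMg; apply: RVM.
    by apply: RRV; exact: RJ.
  (* With [x = r v], the factor [v] is in [W] since [x] and [r] are, so [v ^ k] lies in [W] and
     among the conjugates controlled by [WRV]. *)
  apply: WRV; split; last by exists v => //; exists k.
  apply: WJ; rewrite -(mulKg r v) rvx; apply: WM => //; apply: WV; exact: RW.
exists (W `&` RV); last by split=> [x Rx|x []//]; split; [exact: RW|exact: RRV].
split; last exact: openI.
split=> // x g Xx.
pose T := [set g | (forall x, (W `&` RV) x -> (W `&` RV) (x ^ g)) /\
  (forall x, (W `&` RV) x -> (W `&` RV) (x ^ g^-1))].
suff /(_ g I) [Tg _] : [set: L] `<=` T by exact: Tg.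
rewrite -gK; apply: smallest_sub.
- split=> [|a b [Ta TaV] [Tb TbV]|a [Ta TaV]].
  + by split=> y; rewrite ?invg1 conjg1.
  + split=> y Xy; first by rewrite conjgM; exact/Tb/Ta.
    by rewrite invgM conjgM; exact/TaV/TbV.
  + by split=> // y; rewrite invgK; exact: Ta.
- move=> k Kk; split=> y Xy; apply: XK => //; [by left|by right; exists k].
Qed.

End DiscreteResidual.

(** * Cosets and centralisers *)

Lemma coset_morph (G : topologicalGroupType) (N : normal_subgroup G) :
  {morph @coset G N : x y / x * y}.
Proof. by move=> x y; rewrite -[RHS]/(quotient_mul _ _) quotient_mulE. Qed.

Lemma coset_eq1 (G : topologicalGroupType) (N : normal_subgroup G) x :
  coset N x = 1 <-> (N : set G) x.
Proof.
rewrite -(morph_mulg1 (@coset_morph G N)); split=> [/esym/coset_eqP|Nx].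
  by rewrite invg1 mul1g.
by apply/esym/coset_eqP; rewrite invg1 mul1g.
Qed.

Section Centralizers.
Variable G : groupType.

Lemma subgroup_fix_point (u : G) : is_subgroup [set v | u ^ v = u].
Proof.
split=> [|v w /= uv uw|v /= uv]; first exact: conjg1.
  by rewrite conjgM uv.
by rewrite -{1}uv conjgK.
Qed.

Lemma subgroup_fixed_points (v : G) : is_subgroup [set u | u ^ v = u].
Proof.
split=> [|u w /= uv wv|u /= uv]; first exact: conj1g.
  by rewrite conjMg uv wv.
by rewrite conjVg uv.
Qed.

Lemma conjg_fixC (u v : G) : u ^ v = u -> v ^ u = v.
Proof.
by rewrite !conjgE => uv; apply: (mulgI u); rewrite mulVKg -{1}uv !gnorm.
Qed.

End Centralizers.

(** * The case of a compactly generated source *)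

Section CompactlyGenerated.
Variables (L G : topologicalGroupType) (psi : L -> G).
Hypotheses (tL : tdlcsc L) (tG : tdlcsc G) (npsi : normal_compression psi).

Local Notation act := (conj_act psi).

(** The image of [A] is normalised by that of [L], which is dense in [G]. *)
Lemma closure_image_normal (A : set L) :
  is_normal_subgroup A -> is_normal_subgroup (closure (psi @` A)).
Proof.
have [_ psiM _ _ dpsi] := npsi; move=> [sA AJ]; split.
  exact/closure_subgroup/image_subgroup.
move=> x g cx; refine (dense_normalizer (@closed_closure _ (psi @` A)) dpsi _ g cx).
move=> _ [y _ <-].
apply: closure_conj => _ [z Az <-].
by rewrite -(morph_mulgJ psiM); exists (z ^ y) => //; exact: AJ.
Qed.

(** This stabiliser is closed. Its orbit lies in [psi(L) D / D], which is countable because [W] is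
    open in [L] and maps into [D]; thus it has countable index. *)
Lemma countable_conj_open (W : set L) (D : normal_subgroup G) x :
  open_normal W -> closed (D : set G) -> psi @` W `<=` D ->
  open [set g | coset D (psi x ^ g) = coset D (psi x)].
Proof.
move=> [[sW _] oW] clD WD; have [_ psiM _ _ _] := npsi.
have cM := @coset_morph G D; have cJ := morph_mulgJ cM.
have [r rP] := countable_cosets tL sW oW.
have /choice [f fP] : forall g, exists n, W ((r n)^-1 * act g x).
  by move=> g; exact: rP.
have sC : is_subgroup [set g | coset D (psi x ^ g) = coset D (psi x)].
  rewrite (_ : mkset _ = coset D @^-1` [set v | coset D (psi x) ^ v = coset D (psi x)]).
    by apply: preimage_subgroup => //; exact: subgroup_fix_point.
  by apply/funext => g; rewrite /preimage /= cJ.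
apply: (countable_index_open tG (f := f)) => //.
- rewrite (_ : mkset _ = (fun g => (psi x)^-1 * psi x ^ g) @^-1` (D : set G)).
    apply: preimage_closed => // ? _.
    apply: continuous_mulg; first by move=> ?; exact: cvg_cst.
    exact: conjgr_continuous.
  apply/seteqP; split=> g; first by move=> /esym/coset_eqP.
  by move=> /coset_eqP/esym.
- move=> g h fgh /=.
  suff gh : coset D (psi x ^ g) = coset D (psi x ^ h).
    by rewrite conjgM cJ gh -cJ conjgK.
  rewrite -!(conj_actE npsi); apply/coset_eqP; apply: WD.
  exists ((act g x)^-1 * act h x); last by rewrite psiM (morph_mulgV psiM).
  have [_ WM WV] := sW.
  have := fP h; rewrite -fgh => /(WM _ _ (WV _ (fP g))).
  by rewrite !gnorm.
Qed.

Lemma elementary_of_residual :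
  compactly_generated L ->
  elementary_subset (closure (psi @` discrete_residual L)) -> elementary G.
Proof.
move=> [K cK gK] eM; have [cpsi psiM psiI psiJ dpsi] := npsi.
have [V [sV oV cV _]] := tdlcsc_van_dantzig tL (@filterT _ (nbhs (1 : L)) _).
have [U [sU oU cU _]] := tdlcsc_van_dantzig tG (@filterT _ (nbhs (1 : G)) _).
have [W oW [RW WRV]] := open_normal_in_residual_mul cK gK sV oV cV.
have [nW opW] := oW; have [W1 _ _] := nW.1.
have nM := closure_image_normal (discrete_residual_normal L).
have nD := closure_image_normal nW.
pose M := @NormalSubgroup G (Subgroup nM.1) nM.
pose D := @NormalSubgroup G (Subgroup nD.1) nD.
have clM : closed (M : set G) by exact: closed_closure.
have clD : closed (D : set G) by exact: closed_closure.
have WD : psi @` W `<=` D by exact: subset_closure.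
have MD : (M : set G) `<=` D by apply: closureS => _ [r Rr <-]; exists r => //; exact: RW.
have [[D1 DM DV] DJ] := nD.
have cpsiV : compact (psi @` V).
  by apply: continuous_compact => //; exact: continuous_subspaceT.
(* The product [M psi(V)] is closed and contains [psi(W)], hence its closure [D]. *)
have DMV : (D : set G) `<=` [set m * v | m in M & v in psi @` V].
  have clMV := closed_mul_compact clM cpsiV.
  move=> x Dx; apply: clMV; apply: closureS Dx => _ [w Ww <-].
  have [r Rr [v Vv <-]] := WRV w Ww; exists (psi r).
    by apply: subset_closure; exists r.
  by exists (psi v); [exists v|rewrite psiM].
have cM := @coset_morph G D; have cJ := morph_mulgJ cM.
pose C x := [set g | coset D (psi x ^ g) = coset D (psi x)].
have oC x : open (C x) by exact: (countable_conj_open x oW clD WD).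
pose Cen := \bigcap_(x in [set: L]) C x.
(* Commuting modulo the closed [D] with the dense image of [psi] means commuting with all of [G]. *)
have CenP g y : Cen g -> coset D (y ^ g) = coset D y.
  move=> Cg.
  have cl : closed [set y | (D : set G) (y^-1 * y ^ g)].
    apply: (@preimage_closed _ _ (fun y : G => y^-1 * y ^ g)) => // ? _.
    by apply: continuous_mulg; [exact: invg_continuous|exact: conjgl_continuous].
  apply: esym; apply/coset_eqP; apply: contrapT => nDy.
  have [z [/= nDz [x _ xz]]] := dpsi _ (ex_intro _ y nDy) (closed_openC cl).
  have Dx : (D : set G) ((psi x)^-1 * psi x ^ g).
    by apply/coset_eqP; apply: esym; exact: Cg.
  by apply: nDz; rewrite -xz.
have sCen : is_subgroup Cen.
  apply: subgroup_bigcap => x _.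
  rewrite (_ : C x = coset D @^-1` [set v | coset D (psi x) ^ v = coset D (psi x)]).
    by apply: preimage_subgroup => //; exact: subgroup_fix_point.
  by apply/funext => g; rewrite /C /preimage /= cJ.
(* It suffices to treat the generators [x] in [K]. As [C x] depends only on the coset of [x] modulo
   [W], compactness of [K] leaves finitely many open conditions. *)
have oCen : open Cen.
  apply: (subgroup_open sCen (x := 1)).
  have : nbhs (1 : G) [set g | forall x, K x -> C x g].
    apply: (compact_ind (P := fun A => nbhs (1 : G) [set g | forall x, A x -> C x g]) cK).
    - by apply: filterS filterT => g _ x.
    - move=> A B PA PB; apply: filterS (filterI PA PB) => g [gA gB] x [Ax|Bx].
        exact: gA.
      exact: gB.
    - by move=> A B AB; apply: filterS => g gB x /AB; exact: gB.
    - move=> x _; exists [set y | W (x^-1 * y)].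
        by apply: open_nbhs_nbhs; split; [exact: lcoset_open|rewrite /= mulVg].
      have : nbhs (1 : G) (C x) by apply: open_nbhs_nbhs; split=> //=; rewrite /C /= conjg1.
      apply: filterS => g Cxg y Wxy.
      have xy : coset D (psi y) = coset D (psi x).
        apply: esym; apply/coset_eqP; apply: WD; exists (x^-1 * y) => //.
        by rewrite psiM (morph_mulgV psiM).
      by rewrite /C /= cJ xy -cJ.
  apply: filterS => g KC x _.
  have gKx : generated K x by rewrite gK.
  have pM : {morph coset D \o psi : x y / x * y} by move=> y z /=; rewrite psiM cM.
  have := generated_preimage_sub pM (subgroup_fixed_points (coset D g)) _ gKx.
  by rewrite /C /= cJ; apply => y /KC; rewrite /C /= cJ.
have oDU : open [set d * u | d in (D : set G) & u in U].
  apply: (subgroup_open (x := 1)) (subgroup_mul nD.1 sU _) _ => [d u Dd _|].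
    exact: DJ.
  apply: filterS (open_nbhs1 sU oU) => u Uu.
  by exists 1 => //; exists u; rewrite ?mul1g.
have sDU : is_subgroup [set d * u | d in (D : set G) & u in U].
  by apply: subgroup_mul => // d u Dd _; exact: DJ.
have [U1 _ _] := sU.
have DDU : (D : set G) `<=` [set d * u | d in (D : set G) & u in U].
  by move=> d Dd; exists d => //; exists 1; rewrite ?mulg1.
have DCen : (D : set G) `<=` Cen.
  by move=> d Dd x _; rewrite /C /= cJ ((coset_eq1 D d).2 Dd) conjg1.
pose E := Cen `&` [set d * u | d in (D : set G) & u in U].
have sE : is_subgroup E by exact: subgroupI.
have nE : is_normal_subgroup (Subgroup sE).
  split=> // x g Ex; have [Cx _] := Ex.
  (* Since [x] is central modulo [D], conjugating it changes it by an element of [D], and [D] is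
     contained in [E]. *)
  have Dxg : (D : set G) (x^-1 * x ^ g).
    by apply/coset_eqP; rewrite cJ; apply: esym; apply: conjg_fixC; rewrite -cJ CenP.
  have [_ EM _] := sE; rewrite -(mulVKg x (x ^ g)); apply: EM => //.
  by split; [exact: DCen|exact: DDU].
have oE : open E by exact: openI.
have clE : closed E by exact: open_subgroup_closed.
apply: (@elementary_extension G (NormalSubgroup nE)) => //; last first.
  by right; exact: quotient_discrete.
apply: (elementary_cocompact (A := M) (K := [set a * b | a in psi @` V & b in U])) => //.
- exact: nM.1.
- by move=> x /MD Dx; split; [exact: DCen|exact: DDU].
- by move=> x g Mx _; exact: nM.2.
- exact: compact_mul.
- move=> _ [_ [d /DMV [m Mm [w Vw <-]] [u Uu <-]]]; exists m => //.
  by exists (w * u); [exists w => //; exists u|rewrite mulgA].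
Qed.

End CompactlyGenerated.

(** * Induction on the construction of elementary groups *)

Lemma dense_normal_compression (H : topologicalGroupType) :
  elementary H -> compression_elementary (fun=> True) H.
Proof.
have reduction (H' : topologicalGroupType) :
    compression_elementary compactly_generated H' ->
    compression_elementary (fun=> True) H'.
  move=> cg L G i psi _ tL tG ci iM iI npsi.
  exact: (elementary_of_compactly_generated tL tG ci iM iI npsi cg).
(* Here the residual of [L] dies in [H'], hence is trivial by injectivity of [i]; the closure of its
   image is then the trivial group. *)
have residual1 (H' : topologicalGroupType) : residually_discrete H' ->
    compression_elementary (fun=> True) H'.
  move=> rH; apply: reduction => L G i psi cgL tL tG ci iM iI npsi.
  have [_ psiM _ _ _] := npsi.
  apply: (elementary_of_residual tL tG npsi cgL) => G' j ej jM rj.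
  have G1 (x : G') : x = 1.
    have [jI _ _] := ej; apply: jI; rewrite (morph_mulg1 jM).
    have : range j (j x) by exists x.
    have R1 : discrete_residual L `<=` [set 1].
      move=> y Ry; apply: iI; rewrite (morph_mulg1 iM).
      exact: (discrete_residual_kernel rH ci iM Ry).
    have cl1 : closed [set (1 : G)].
      by apply: compact_closed; [case: tG|exact: compact_set1].
    rewrite rj => jx; apply: cl1; apply: closureS jx => _ [y /R1 -> <-].
    exact: morph_mulg1.
  apply: elementary_discrete.
    move=> A; have [A1|nA1] := pselect (A 1).
      rewrite (_ : A = setT); first exact: openT.
      by apply/seteqP; split=> // x _; rewrite (G1 x).
    rewrite (_ : A = set0); first exact: open0.
    by apply/seteqP; split=> // x; rewrite (G1 x).
  rewrite (_ : setT = [set 1]); first exact: countable1.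
  by apply/seteqP; split=> // x _; rewrite (G1 x).
elim=> {}H.
- by move=> pH _; apply/residual1/profinite_residually_discrete.
- by move=> dH _; apply/residual1/discrete_residually_discrete.
- move=> N tH clN _ IHN qN; apply: reduction => L G i psi cgL tL tG ci iM iI npsi.
  have [cpsi psiM psiI _ _] := npsi.
  apply: (elementary_of_residual tL tG npsi cgL) => G' j ej jM rj.
  have [sR RJ] := discrete_residual_normal L.
  pose R := Subgroup sR.
  pose v : subgroup_type R -> L := val.
  have ev : embedding v := subgroup_val_embedding R.
  have vM : {morph v : x y / x * y} := @subgroup_val_morph L R.
  have rv : range v = R := range_subgroup_val R.
  have [vI cv _] := ev.
  have rq : residually_discrete (quotient_group N).
    case: qN; first exact: profinite_residually_discrete.
    exact: discrete_residually_discrete.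
  (* The residual dies in [H/N], so [i] restricts to a map from [R] to [N], to which the induction
     hypothesis applies. *)
  have RN x : (R : set L) x -> (N : set H) (i x).
    move=> Rx; apply/coset_eq1.
    apply: (discrete_residual_kernel (f := coset N \o i) rq) => //.
      by move=> y; apply: continuous_comp; [exact: ci|exact: coset_continuous].
    by move=> y z /=; rewrite iM coset_morph.
  have eN := subgroup_val_embedding N; have [nI _ _] := eN.
  have [||||i' [ci' i'M i'E]] := @corestriction _ _ _ (i \o v) _ eN.
  - exact: subgroup_val_morph.
  - by move=> x; apply: continuous_comp; [exact: cv|exact: ci].
  - by move=> x y /=; rewrite vM iM.
  - move=> _ [x _ <-]; rewrite range_subgroup_val; apply: RN.
    by rewrite -rv; exists x.
  have rpv : range (psi \o v) = psi @` R by exact: range_comp.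
  have [|||||f' nf'] := @normal_compression_closure _ _ _ (psi \o v) j ej jM.
  - by move=> x; apply: continuous_comp; [exact: cv|exact: cpsi].
  - by move=> x y /=; rewrite vM psiM.
  - exact: inj_comp.
  - by rewrite rpv.
  - move=> x g _; rewrite rpv /= -(conj_actE npsi); exists (conj_act psi g (v x)) => //.
    (* All of [G] normalises [psi(R)]: its elements act on [L] by continuous endomorphisms, which
       pull open normal subgroups back to such subgroups. *)
    move=> W oW; have := open_normal_preimage (@conj_act_continuous L G psi tL tG npsi g)
      (@conj_actM L G psi npsi g) oW.
    by apply: (_ : (R : set L) (v x)); rewrite -rv; exists x.
  apply: (IHN _ _ i' f') => //.
  - apply: (tdlcsc_embedding tL ev); rewrite rv; exact: discrete_residual_closed.
  - by apply: (tdlcsc_embedding tG ej); rewrite rj; exact: closed_closure.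
  - move=> x y xy; apply/vI/iI; change ((i \o v) x = (i \o v) y).
    by rewrite -i'E /= xy.
- move=> O tH oO OS Ocov _ IHO.
  apply: reduction => L G i psi [K cK gK] tL tG ci iM iI npsi.
  (* Once a compact generating set is sent into one [O n], so is all of [L]. *)
  have [n Kn] : exists n, K `<=` i @^-1` (O n).
    apply: compact_increasing_cover => //.
    + by move=> n; move/continuousP: ci; exact.
    + by move=> n x; exact: OS.
    + move=> x _; have : (\bigcup_n (O n : set H)) (i x) by rewrite Ocov.
      by move=> [n _ Ox]; exists n.
  have iO : range i `<=` range (val : subgroup_type (O n) -> H).
    move=> _ [x _ <-]; rewrite range_subgroup_val.
    by apply: (generated_preimage_sub iM (subgroupP (O n)) Kn); rewrite gK.
  have eO := subgroup_val_embedding (O n).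
  have [i' [ci' i'M i'E]] := corestriction eO (@subgroup_val_morph _ _) ci iM iO.
  apply: (IHO n _ _ i' psi) => //.
  by move=> x y xy; apply: iI; rewrite -i'E /= xy.
Qed.

Theorem theorem1p4 (H G : topologicalGroupType) (psi : {multiplicative H -> G}) :
  elementary H -> tdlcsc G ->
  continuous psi -> injective psi ->
  is_normal_subgroup (range psi) -> dense (range psi) ->
  elementary G.
Proof.
move=> eH tG cpsi psiI [_ psiJ] dpsi.
apply: (dense_normal_compression eH (i := id) (psi := psi)) => //.
- exact: elementary_tdlcsc.
- by move=> x; exact: cvg_id.
- split=> //; first exact: gmulfM.
  by move=> x g; apply: psiJ; exists x.
Qed.
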